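(* Let $0<\alpha<1$ and $f\in\mathcal{BS}(\alpha)$. Then for $|z|=r$, $0<r<1$, $$-\hat f(-r)\le|f(z)|\le\hat f(r),\qquad\text{where}\quad \hat f(z)=z\left(\frac{1+z\sqrt\alpha}{1-z\sqrt\alpha}\right)^{\frac1{2\sqrt\alpha}}.$$ The result is sharp (for each $r$, each bound is attained by some function of $\mathcal{BS}(\alpha)$ at some point with $|z|=r$).
   Context: $\Delta=\{z\in\mathbb{C}:|z|<1\}$. $\mathcal{A}$ is the class of analytic functions $f(z)=z+\sum_{k\ge2}a_kz^k$ in $\Delta$. For analytic $g,h$ on $\Delta$, $g\prec h$ (subordination) means $g=h\circ\omega$ for some analytic $\omega:\Delta\to\Delta$ with $\omega(0)=0$. $\mathcal{BS}(\alpha)$ is the class of $f\in\mathcal{A}$ with $\frac{zf'(z)}{f(z)}-1\prec\frac{z}{1-\alpha z^2}$ in $\Delta$ (in particular $zf'(z)/f(z)$ is analytic in $\Delta$). Powers are principal branches. *)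

(* Defs.v *)
From Stdlib Require Import Reals.
From Coquelicot Require Import Coquelicot.

Open Scope R_scope.

Definition Delta (z : C) : Prop := Cmod z < 1.

(* Complex differentiability at every point of the open disc.  Functions are
   total on C; their values outside Delta play no role. *)
Definition analytic (f : C -> C) : Prop :=
  forall z : C, Delta z ->
    ex_derive (K := C_AbsRing) (V := C_NormedModule) f z.

Definition class_A (f : C -> C) : Prop :=
  analytic f /\
  exists a : nat -> C,
    a 0%nat = RtoC 0 /\ a 1%nat = RtoC 1 /\
    forall z : C, Delta z ->
      is_pseries (K := C_AbsRing) (V := C_NormedModule) a z (f z).

Definition subordinate (g h : C -> C) : Prop :=
  analytic g /\ analytic h /\
  exists omega : C -> C,
    analytic omega /\
    (forall z : C, Delta z -> Delta (omega z)) /\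
    omega (RtoC 0) = RtoC 0 /\
    (forall z : C, Delta z -> g z = h (omega z)).

(* z f'(z) / f(z); for f in class_A it has a removable singularity at 0, where
   its limit is 1, whereas the total division of C would give 0 there. *)
Definition zdlog (f : C -> C) (z : C) : C :=
  if Ceq_dec z (RtoC 0) then RtoC 1 else (z * C_derive f z / f z)%C.

(* f must not vanish off 0: otherwise z f'(z) / f(z) has a pole in Delta. *)
Definition BS (alpha : R) (f : C -> C) : Prop :=
  class_A f /\
  (forall z : C, Delta z -> z <> RtoC 0 -> f z <> RtoC 0) /\
  subordinate (fun z => (zdlog f z - 1)%C)
              (fun z => (z / (1 - alpha * z ^ 2))%C).

Definition Cexp (z : C) : C := (exp (Re z) * cos (Im z), exp (Re z) * sin (Im z)).

(* Principal argument, in (-PI, PI]; meaningful for z <> 0. *)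
Definition Arg (z : C) : R :=
  if Rle_dec 0 (Im z) then acos (Re z / Cmod z) else - acos (Re z / Cmod z).

Definition Clog (z : C) : C := (ln (Cmod z), Arg z).

(* Principal branch of w ^ c; meaningful for w <> 0. *)
Definition Cpower (w c : C) : C := Cexp (c * Clog w).

Definition fhat (alpha : R) (z : C) : C :=
  (z * Cpower ((1 + z * sqrt alpha) / (1 - z * sqrt alpha))
              (1 / (2 * sqrt alpha)))%C.

(* An inequality between complex numbers: it asserts in particular that their
   difference is real. *)
Definition Cle (x y : C) : Prop := Im x = Im y /\ Re x <= Re y.

(* Main.v *)
From Stdlib Require Import Reals Lra Psatz List ClassicalEpsilon.
From Coquelicot Require Import Coquelicot.
Require Import Defs.

Open Scope R_scope.

(** Write g = z f'/f - 1 = w / (1 - alpha w^2), where w is the subordinating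
    function.  By the Schwarz lemma |w(z)| <= |z|, so
    |g(z)| <= r / (1 - alpha r^2) on |z| = r.  Along a ray z = t u with |u| = 1
    the derivative of log (|f(t u)| / t) is Re g(t u) / t, which therefore lies
    between -1 / (1 - alpha t^2) and 1 / (1 - alpha t^2).  A primitive of
    1 / (1 - alpha t^2) is
      K(t) = log ((1 + t sqrt alpha) / (1 - t sqrt alpha)) / (2 sqrt alpha),
    and log (|f(t u)| / t) tends to 0 with t because f'(0) = 1.  Comparing the
    two functions on ]0, r] gives r exp(-K(r)) <= |f(z)| <= r exp(K(r)), which
    are the two bounds ([BS_growth], [fhat_real], [opp_fhat_opp]).

    The Schwarz lemma is obtained without contour integrals.  If P is twice
    complex differentiable then |P|^2 + eps |z|^2 has a strictly positive
    Laplacian, hence no interior maximum ([max_principle]).  Applied to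
    w^(n+1) / z^n, which vanishes at 0, this yields |w|^(n+1) <= |z|^n for all n,
    and so |w| <= |z| ([Schwarz_lemma]).  That w is twice differentiable away
    from 0 comes from f: a power series may be differentiated term by term
    ([is_cderive_pseries]), so g is twice differentiable, and w inherits this
    because w -> w / (1 - alpha w^2) has a derivative without zeros in the disc
    ([twice_cdiff_subordinating]).

    For sharpness take w(z) = z.  The solution f = z F of the equation
    z f'/f - 1 = z / (1 - alpha z^2) is constructed from the recurrence of its
    Taylor coefficients, which lie in [0, 1]; F has no zero since F(z) F(-z) = 1.
    On the two rays through 1 and -1 the comparison above is an equality
    ([extremal_modulus]), so f attains the upper bound at r and the lower bound
    at -r. *)

(** * Complex derivatives *)

Notation is_cderive :=
  (is_derive (K := C_AbsRing) (V := C_NormedModule)) (only parsing).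

(** Neighbourhoods of z in terms of the modulus: the plane carries both the
    product uniform structure and the one of its absolute value, and epsilon-delta
    estimates avoid choosing between them. *)
Definition cnear (z : C) (P : C -> Prop) : Prop :=
  exists d : R, 0 < d /\ forall y : C, Cmod (y - z) < d -> P y.

Lemma cnear_and z P Q : cnear z P -> cnear z Q -> cnear z (fun y => P y /\ Q y).
Proof.
intros [d [Hd HP]] [e [He HQ]]; exists (Rmin d e); split.
  now apply Rmin_pos.
intros y Hy; split; [apply HP | apply HQ];
  (eapply Rlt_le_trans; [apply Hy |]); [apply Rmin_l | apply Rmin_r].
Qed.

Lemma cnear_imp z (P Q : C -> Prop) :
  (forall y, P y -> Q y) -> cnear z P -> cnear z Q.
Proof. intros H [d [Hd HP]]; exists d; split; auto. Qed.

Lemma cnear_self z P : cnear z P -> P z.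
Proof.
intros [d [Hd HP]]; apply HP.
replace (z - z)%C with (RtoC 0) by ring. now rewrite Cmod_0.
Qed.

Lemma cnear_locally z (P : C -> Prop) :
  cnear z P <-> locally (T := AbsRing_UniformSpace C_AbsRing) z P.
Proof.
split.
- intros [d [Hd H]]; exists (mkposreal d Hd); intros y Hy; apply H; exact Hy.
- intros [d H]; exists d; split; [apply cond_pos | intros y Hy; apply H; exact Hy].
Qed.

Lemma cnear_cnear z P : cnear z P -> cnear z (fun y => cnear y P).
Proof.
intros [d [Hd H]]; exists (d/2); split; [lra|].
intros y Hy; exists (d/2); split; [lra|].
intros x Hx; apply H.
replace (x - z)%C with ((x - y) + (y - z))%C by ring.
eapply Rle_lt_trans; [apply Cmod_triangle | lra].
Qed.

Lemma is_cderive_eps (f : C -> C) (z l : C) :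
  is_cderive f z l <->
  (forall eps, 0 < eps ->
     cnear z (fun y => Cmod (f y - f z - (y - z) * l) <= eps * Cmod (y - z))).
Proof.
split.
- intros [_ H] eps Heps.
  specialize (H z (fun P HP => HP) (mkposreal eps Heps)).
  apply cnear_locally; exact H.
- intros H; split.
  + apply (is_linear_scal_l (V := C_NormedModule)).
  + intros x Hx eps.
    apply (is_filter_lim_locally_unique (V := AbsRing_NormedModule C_AbsRing)) in Hx.
    subst x.
    specialize (H eps (cond_pos eps)).
    apply cnear_locally in H; exact H.
Qed.

(** C is a normed module over itself in two ways that are not convertible, but
    with the same modulus.  General product and chain rules concern the module on
    the right; transferring through this equivalence makes them available. *)
Lemma is_cderive_ring (f : C -> C) (z l : C) :
  is_cderive f z l <->
  is_derive (K := C_AbsRing) (V := AbsRing_NormedModule C_AbsRing) f z l.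
Proof.
split; intros [[H1 H2 H3] H4]; (split; [split |]); assumption.
Qed.

Lemma is_cderive_near_ext (f g : C -> C) (z l : C) :
  cnear z (fun y => f y = g y) -> is_cderive f z l -> is_cderive g z l.
Proof.
intros H; apply is_derive_ext_loc; now apply cnear_locally.
Qed.

Lemma is_cderive_eq f (z l m : C) : is_cderive f z l -> l = m -> is_cderive f z m.
Proof. intros H <-; exact H. Qed.

Lemma is_cderive_const (c z : C) : is_cderive (fun _ => c) z (RtoC 0).
Proof. apply (is_derive_const (V := C_NormedModule)). Qed.

Lemma is_cderive_id (z : C) : is_cderive (fun y => y) z (RtoC 1).
Proof. apply is_cderive_ring, (is_derive_id (K := C_AbsRing)). Qed.

Lemma is_cderive_plus f g (z l m : C) :
  is_cderive f z l -> is_cderive g z m -> is_cderive (fun y => f y + g y)%C z (l + m)%C.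
Proof. apply (is_derive_plus (V := C_NormedModule)). Qed.

Lemma is_cderive_minus f g (z l m : C) :
  is_cderive f z l -> is_cderive g z m -> is_cderive (fun y => f y - g y)%C z (l - m)%C.
Proof. apply (is_derive_minus (V := C_NormedModule)). Qed.

Lemma is_cderive_mult f g (z l m : C) :
  is_cderive f z l -> is_cderive g z m ->
  is_cderive (fun y => f y * g y)%C z (l * g z + f z * m)%C.
Proof.
intros Hf Hg; apply is_cderive_ring.
apply (is_derive_mult (K := C_AbsRing)); [now apply is_cderive_ring.. | exact Cmult_comm].
Qed.

Lemma is_cderive_comp f g (z l m : C) :
  is_cderive f (g z) l -> is_cderive g z m -> is_cderive (fun y => f (g y)) z (m * l)%C.
Proof.
intros Hf Hg.
apply (is_derive_comp (K := C_AbsRing) (V := C_NormedModule)); [assumption |].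
now apply is_cderive_ring.
Qed.

Lemma is_cderive_cont f z l :
  is_cderive f z l -> forall eps, 0 < eps -> cnear z (fun y => Cmod (f y - f z) < eps).
Proof.
intros H eps Heps.
apply is_cderive_eps with (eps := 1) in H; [| lra].
assert (Hl := Cmod_ge_0 l).
destruct H as [d [Hd H]].
set (e := eps / (2 * (1 + Cmod l))).
assert (He : 0 < e) by (apply Rdiv_lt_0_compat; lra).
exists (Rmin d e); split; [now apply Rmin_pos |].
intros y Hy.
assert (Hy1 := Rlt_le_trans _ _ _ Hy (Rmin_l _ _)).
assert (Hy2 := Rlt_le_trans _ _ _ Hy (Rmin_r _ _)).
specialize (H y Hy1).
replace (f y - f z)%C with ((f y - f z - (y - z) * l) + (y - z) * l)%C by ring.
eapply Rle_lt_trans; [apply Cmod_triangle |].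
rewrite Cmod_mult.
assert (Cmod (y - z) * (1 + Cmod l) < eps); [| lra].
apply Rle_lt_trans with (e * (1 + Cmod l)); [apply Rmult_le_compat_r; lra |].
replace (e * (1 + Cmod l)) with (eps / 2) by (unfold e; field; lra). lra.
Qed.

Lemma is_cderive_neq0 f z l :
  is_cderive f z l -> f z <> RtoC 0 -> cnear z (fun y => f y <> RtoC 0).
Proof.
intros H Hz. apply Cmod_gt_0 in Hz.
eapply cnear_imp; [| apply (is_cderive_cont _ _ _ H _ Hz)].
intros y Hy E; cbv beta in Hy; rewrite E in Hy.
replace (0 - f z)%C with (- f z)%C in Hy by ring.
rewrite Cmod_opp in Hy; lra.
Qed.

Lemma is_cderive_Cinv (z : C) : z <> RtoC 0 -> is_cderive Cinv z (- / (z * z))%C.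
Proof.
intros Hz. assert (Hm : 0 < Cmod z) by now apply Cmod_gt_0.
apply is_cderive_eps; intros eps Heps.
set (m := Cmod z) in *.
set (e := eps * m ^ 3 / 2).
assert (He : 0 < e) by (unfold e; assert (0 < m ^ 3) by (apply pow_lt; lra); nra).
exists (Rmin (m / 2) e); split; [apply Rmin_pos; lra |].
intros y Hy.
assert (Hy1 := Rlt_le_trans _ _ _ Hy (Rmin_l _ _)).
assert (Hy2 := Rlt_le_trans _ _ _ Hy (Rmin_r _ _)).
assert (Hym : m / 2 <= Cmod y).
{ assert (m <= Cmod y + Cmod (y - z)); [| lra].
  unfold m; replace z with (y + - (y - z))%C at 1 by ring.
  eapply Rle_trans; [apply Cmod_triangle | rewrite Cmod_opp; lra]. }
assert (Hy0 : y <> RtoC 0) by (apply Cmod_gt_0; lra).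
(* 1/y - 1/z + (y - z)/z^2 = (y - z)^2 / (y z^2), and |y| >= |z|/2 near z *)
replace (/ y - / z - (y - z) * - / (z * z))%C
  with ((y - z) * (y - z) * / (y * (z * z)))%C by (field; auto).
rewrite !Cmod_mult, Cmod_inv, !Cmod_mult.
2: now repeat apply Cmult_neq_0.
fold m. set (D := Cmod (y - z)) in *.
assert (HD : 0 <= D) by apply Cmod_ge_0.
replace (D * D * / (Cmod y * (m * m))) with ((D * / (Cmod y * (m * m))) * D) by ring.
apply Rmult_le_compat_r; [exact HD |].
apply Rmult_le_reg_r with (Cmod y * (m * m)).
  apply Rmult_lt_0_compat; nra.
rewrite Rmult_assoc, Rinv_l by (apply Rgt_not_eq, Rmult_lt_0_compat; nra).
unfold e in Hy2.
assert (0 < m * m) by nra.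
assert (m / 2 * (m * m) <= Cmod y * (m * m)) by (apply Rmult_le_compat_r; lra).
assert (eps * (m / 2 * (m * m)) <= eps * (Cmod y * (m * m))) by (apply Rmult_le_compat_l; lra).
lra.
Qed.

Lemma is_cderive_inv f (z l : C) :
  is_cderive f z l -> f z <> RtoC 0 ->
  is_cderive (fun y => / f y)%C z (- l / (f z * f z))%C.
Proof.
intros H H0.
eapply is_cderive_eq; [apply (is_cderive_comp Cinv f z _ l (is_cderive_Cinv _ H0) H) |].
now field.
Qed.

(** * Twice differentiable functions *)

(** The regularity used by the maximum principle.  Asking for the second
    derivative at the single point z keeps the closure properties below within the
    product and chain rules at z. *)
Definition twice_cdiff (f : C -> C) (z : C) : Prop :=
  exists (f' : C -> C) (l : C),
    cnear z (fun y => is_cderive f y (f' y)) /\ is_cderive f' z l.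

Lemma twice_cdiff_near_ext f g z :
  cnear z (fun y => f y = g y) -> twice_cdiff f z -> twice_cdiff g z.
Proof.
intros He [f' [l [H1 H2]]]; exists f', l; split; [| exact H2].
apply cnear_cnear in He.
eapply cnear_imp; [| apply (cnear_and _ _ _ He H1)].
intros y [Hy1 Hy2]; eapply is_cderive_near_ext; eauto.
Qed.

Lemma twice_cdiff_const c z : twice_cdiff (fun _ => c) z.
Proof.
exists (fun _ => RtoC 0); eexists; split.
- exists 1; split; [lra | intros; apply is_cderive_const].
- apply is_cderive_const.
Qed.

Lemma twice_cdiff_id z : twice_cdiff (fun y => y) z.
Proof.
exists (fun _ => RtoC 1); eexists; split.
- exists 1; split; [lra | intros; apply is_cderive_id].
- apply is_cderive_const.
Qed.

Lemma twice_cdiff_minus f g z :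
  twice_cdiff f z -> twice_cdiff g z -> twice_cdiff (fun y => f y - g y)%C z.
Proof.
intros [f' [l [Hf Hl]]] [g' [m [Hg Hm]]].
exists (fun y => f' y - g' y)%C; eexists; split.
- eapply cnear_imp; [| apply (cnear_and _ _ _ Hf Hg)].
  intros y [H1 H2]; now apply is_cderive_minus.
- apply is_cderive_minus; eassumption.
Qed.

Lemma twice_cdiff_mult f g z :
  twice_cdiff f z -> twice_cdiff g z -> twice_cdiff (fun y => f y * g y)%C z.
Proof.
intros [f' [l [Hf Hl]]] [g' [m [Hg Hm]]].
exists (fun y => f' y * g y + f y * g' y)%C; eexists; split.
- eapply cnear_imp; [| apply (cnear_and _ _ _ Hf Hg)].
  intros y [H1 H2]; now apply is_cderive_mult.
- apply is_cderive_plus; apply is_cderive_mult;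
    first [eassumption | apply (cnear_self _ _ Hf) | apply (cnear_self _ _ Hg)].
Qed.

Lemma twice_cdiff_inv f z :
  twice_cdiff f z -> f z <> RtoC 0 -> twice_cdiff (fun y => / f y)%C z.
Proof.
intros [f' [l [Hf Hl]]] H0.
assert (Hz := cnear_self _ _ Hf); cbv beta in Hz.
exists (fun y => (RtoC 0 - f' y) * / (f y * f y))%C; eexists; split.
- eapply cnear_imp; [| apply (cnear_and _ _ _ Hf (is_cderive_neq0 _ _ _ Hz H0))].
  intros y [H1 H2].
  eapply is_cderive_eq; [exact (is_cderive_inv f y _ H1 H2) | now field].
- apply is_cderive_mult.
  + apply is_cderive_minus; [apply is_cderive_const | eassumption].
  + apply is_cderive_inv; [apply is_cderive_mult; eassumption |].
    now apply Cmult_neq_0.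
Qed.

Lemma twice_cdiff_pow f z n : twice_cdiff f z -> twice_cdiff (fun y => f y ^ n)%C z.
Proof.
intros H; induction n as [| n IH]; simpl.
- apply twice_cdiff_const.
- now apply twice_cdiff_mult.
Qed.

(** * The maximum principle *)

Lemma im_le_Cmod (c : C) : Rabs (Im c) <= Cmod c.
Proof. eapply Rle_trans; [apply Rmax_r | apply (Rmax_Cmod c)]. Qed.

(** The common part of the derivatives of Re P and Im P along a line: only
    real linearity of L and |L| <= modulus matter. *)
Lemma is_derive_line_functional (L : C -> R) :
  (forall a b, L (a - b)%C = L a - L b) -> (forall (h : R) a, L (RtoC h * a)%C = h * L a) ->
  (forall a, Rabs (L a) <= Cmod a) ->
  forall (P : C -> C) (p d l : C) (t : R),
  is_cderive P (p + RtoC t * d)%C l ->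
  is_derive (fun s : R => L (P (p + RtoC s * d)%C)) t (L (d * l)%C).
Proof.
intros Lminus Lscal Lle P p d l t H.
apply is_derive_Reals; intros eps Heps.
assert (Hd := Cmod_ge_0 d).
set (e := eps / (2 * (1 + Cmod d))).
assert (He : 0 < e) by (apply Rdiv_lt_0_compat; lra).
assert (Hee : e * (1 + Cmod d) = eps / 2) by (unfold e; field; lra).
destruct (proj1 (is_cderive_eps _ _ _) H e He) as [r [Hr HP]].
assert (Hr' : 0 < r / (1 + Cmod d)) by (apply Rdiv_lt_0_compat; lra).
exists (mkposreal _ Hr'); intros h Hh0 Hh; simpl in Hh.
specialize (HP (p + RtoC (t + h) * d)%C).
replace (p + RtoC (t + h) * d - (p + RtoC t * d))%C with (RtoC h * d)%C in HP
  by (rewrite RtoC_plus; ring).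
rewrite Cmod_mult, Cmod_R in HP.
assert (Hh' : 0 < Rabs h) by now apply Rabs_pos_lt.
assert (HP' : Rabs h * Cmod d < r).
{ apply Rle_lt_trans with (Rabs h * (1 + Cmod d)); [nra |].
  apply Rmult_lt_compat_r with (r := 1 + Cmod d) in Hh; [| lra].
  unfold Rdiv in Hh; rewrite Rmult_assoc, Rinv_l in Hh; lra. }
specialize (HP HP'). clear HP'.
set (X := (P (p + RtoC (t + h) * d) - P (p + RtoC t * d) - RtoC h * d * l)%C) in *.
replace ((L (P (p + RtoC (t + h) * d)%C) - L (P (p + RtoC t * d)%C)) / h - L (d * l)%C)
  with (L X / h).
2:{ unfold X. rewrite !Lminus.
    replace (RtoC h * d * l)%C with (RtoC h * (d * l))%C by ring.
    rewrite Lscal. now field. }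
unfold Rdiv; rewrite Rabs_mult, Rabs_inv.
apply Rmult_lt_reg_r with (Rabs h); [assumption |].
rewrite Rmult_assoc, Rinv_l, Rmult_1_r by lra.
eapply Rle_lt_trans; [apply Lle |].
eapply Rle_lt_trans; [apply HP |].
replace (e * (Rabs h * Cmod d)) with ((e * Cmod d) * Rabs h) by ring.
apply Rmult_lt_compat_r; [assumption | nra].
Qed.

Lemma is_derive_line_Re (P : C -> C) (p d l : C) (t : R) :
  is_cderive P (p + RtoC t * d)%C l ->
  is_derive (fun s : R => Re (P (p + RtoC s * d)%C)) t (Re (d * l)%C).
Proof.
apply (is_derive_line_functional Re).
- intros; unfold Cminus; rewrite re_plus, re_opp; ring.
- intros; apply re_scal_l.
- intros; apply re_le_Cmod.
Qed.

Lemma is_derive_line_Im (P : C -> C) (p d l : C) (t : R) :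
  is_cderive P (p + RtoC t * d)%C l ->
  is_derive (fun s : R => Im (P (p + RtoC s * d)%C)) t (Im (d * l)%C).
Proof.
apply (is_derive_line_functional Im).
- intros [a1 a2] [b1 b2]; simpl; ring.
- intros h [a1 a2]; simpl; ring.
- intros; apply im_le_Cmod.
Qed.

Lemma is_derive_eq (f : R -> R) (t l m : R) : is_derive f t l -> l = m -> is_derive f t m.
Proof. intros H <-; exact H. Qed.

Lemma is_derive_line_Cmod2 (P : C -> C) (p d l : C) (t : R) :
  is_cderive P (p + RtoC t * d)%C l ->
  is_derive (fun s : R => Cmod (P (p + RtoC s * d)%C) ^ 2) t
    (2 * (Re (P (p + RtoC t * d)%C) * Re (d * l)%C
          + Im (P (p + RtoC t * d)%C) * Im (d * l)%C)).
Proof.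
intros H.
apply (is_derive_ext (fun s : R => Re (P (p + RtoC s * d)%C) ^ 2 + Im (P (p + RtoC s * d)%C) ^ 2)).
{ intros s; symmetry; apply Cmod2_alt. }
assert (H1 := is_derive_line_Re _ _ _ _ _ H).
assert (H2 := is_derive_line_Im _ _ _ _ _ H).
eapply is_derive_eq.
- apply (is_derive_plus (K := R_AbsRing) (V := R_NormedModule)).
  + apply is_derive_pow; exact H1.
  + apply is_derive_pow; exact H2.
- unfold plus; simpl. ring.
Qed.

(** Form of the second-derivative test without assuming a critical point: f1 is
    strictly monotone through 0, so f increases to the right if f1 0 >= 0 and to the
    left otherwise. *)
Lemma convex_not_max (f f1 : R -> R) (c d : R) :
  0 < d -> (forall t, Rabs t < d -> is_derive f t (f1 t)) ->
  is_derive f1 0 c -> 0 < c -> exists t, Rabs t < d /\ f 0 < f t.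
Proof.
intros Hd Hf Hf1 Hc.
apply is_derive_Reals in Hf1.
destruct (Hf1 (c / 2)) as [[e He] H]; [lra |]; simpl in H.
set (m := Rmin d e / 2).
assert (Hm : 0 < m /\ m < d /\ m < e).
{ unfold m; assert (H1 := Rmin_l d e); assert (H2 := Rmin_r d e).
  assert (0 < Rmin d e) by now apply Rmin_pos. lra. }
assert (Hslope : forall s, Rabs s <= m -> (0 < s -> f1 0 < f1 s) /\ (s < 0 -> f1 s < f1 0)).
{ intros s Hs.
  assert (HH : s <> 0 -> 0 < (f1 s - f1 0) / s).
  { intros Hs0; specialize (H s Hs0 ltac:(lra)).
    rewrite Rplus_0_l in H. apply Rabs_def2 in H. lra. }
  split; intros Hs0; specialize (HH ltac:(lra)).
  - assert (0 < (f1 s - f1 0) / s * s) by (apply Rmult_lt_0_compat; lra).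
    unfold Rdiv in H0; rewrite Rmult_assoc, Rinv_l in H0; lra.
  - assert (0 < (f1 s - f1 0) / s * (- s)) by (apply Rmult_lt_0_compat; lra).
    unfold Rdiv in H0. replace ((f1 s - f1 0) * / s * - s) with (- (f1 s - f1 0)) in H0 by (field; lra).
    lra. }
assert (Habs : forall t, - m <= t <= m -> Rabs t <= m) by (intros; now apply Rabs_le).
destruct (Rle_dec 0 (f1 0)) as [H0 | H0].
- exists m; split; [rewrite Rabs_pos_eq; lra |].
  destruct (MVT_cor2 f f1 0 m) as [x [Hx1 Hx2]]; [lra | |].
  { intros x Hx; apply is_derive_Reals, Hf. specialize (Habs x ltac:(lra)); lra. }
  destruct (Hslope x (Habs x ltac:(lra))) as [Hs _]; specialize (Hs ltac:(lra)). nra.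
- exists (- m); split; [rewrite Rabs_Ropp, Rabs_pos_eq; lra |].
  destruct (MVT_cor2 f f1 (- m) 0) as [x [Hx1 Hx2]]; [lra | |].
  { intros x Hx; apply is_derive_Reals, Hf. specialize (Habs x ltac:(lra)); lra. }
  destruct (Hslope x (Habs x ltac:(lra))) as [_ Hs]; specialize (Hs ltac:(lra)). nra.
Qed.

(** The second derivatives of |P|^2 along the directions 1 and i are
    2|P'|^2 + 2S and 2|P'|^2 - 2S with S = Re (conj P * P'').  One of the two is
    nonnegative, and eps |z|^2 contributes a further 2 eps. *)
Lemma strictly_subharmonic_not_max (P : C -> C) (z : C) (eps d : R) :
  twice_cdiff P z -> 0 < eps -> 0 < d ->
  exists y, Cmod (y - z) < d /\
    Cmod (P z) ^ 2 + eps * Cmod z ^ 2 < Cmod (P y) ^ 2 + eps * Cmod y ^ 2.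
Proof.
intros [P1 [P2 [[r [Hr HP]] HP2]]] Heps Hd.
set (S := Re (P z) * Re P2 + Im (P z) * Im P2).
assert (Hdir : exists u : C, Cmod u = 1 /\
   0 <= Re (P z) * Re (u * (u * P2)) + Im (P z) * Im (u * (u * P2))).
{ destruct (Rle_dec 0 S) as [HS | HS].
  - exists (RtoC 1); split; [apply Cmod_1 |].
    replace (RtoC 1 * (RtoC 1 * P2))%C with P2 by ring. exact HS.
  - exists Ci; split; [apply Cmod_Ci |].
    replace (Ci * (Ci * P2))%C with (- P2)%C.
    + unfold S in HS; simpl; unfold Re, Im in *; lra.
    + destruct P2 as [a b]; apply injective_projections; simpl; ring. }
destruct Hdir as [u [Hu HS]].
set (phi := fun t : R => Cmod (P (z + RtoC t * u)%C) ^ 2 + eps * Cmod (z + RtoC t * u) ^ 2).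
set (phi1 := fun t : R =>
  2 * (Re (P (z + RtoC t * u)%C) * Re (u * P1 (z + RtoC t * u)%C)%C
       + Im (P (z + RtoC t * u)%C) * Im (u * P1 (z + RtoC t * u)%C)%C)
  + eps * (2 * (Re (z + RtoC t * u) * Re (u * RtoC 1)%C + Im (z + RtoC t * u) * Im (u * RtoC 1)%C))).
assert (Hz0 : (z + RtoC 0 * u)%C = z) by ring.
destruct (convex_not_max phi phi1
   (2 * (Cmod (u * P1 z) ^ 2 + (Re (P z) * Re (u * (u * P2)) + Im (P z) * Im (u * (u * P2))))
     + 2 * eps) (Rmin d r)) as [t [Ht1 Ht2]].
- now apply Rmin_pos.
- intros t Ht. assert (Hr' := Rlt_le_trans _ _ _ Ht (Rmin_r _ _)).
  apply (is_derive_plus (K := R_AbsRing) (V := R_NormedModule)).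
  + apply is_derive_line_Cmod2. apply HP.
    replace (z + RtoC t * u - z)%C with (RtoC t * u)%C by ring.
    rewrite Cmod_mult, Cmod_R, Hu; lra.
  + apply is_derive_scal.
    apply (is_derive_line_Cmod2 (fun y => y)), is_cderive_id.
- assert (D0 : is_cderive P (z + RtoC 0 * u)%C (P1 z)).
  { rewrite Hz0. apply HP. replace (z - z)%C with (RtoC 0) by ring. now rewrite Cmod_0. }
  assert (D1 : is_cderive (fun y => u * P1 y)%C (z + RtoC 0 * u)%C (u * P2)%C).
  { rewrite Hz0. eapply is_cderive_eq.
    - apply is_cderive_mult; [apply is_cderive_const | exact HP2].
    - cbv beta; ring. }
  assert (D2 : is_cderive (fun y => y) (z + RtoC 0 * u)%C (RtoC 1)) by apply is_cderive_id.
  eapply is_derive_eq.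
  + apply (is_derive_plus (K := R_AbsRing) (V := R_NormedModule)).
    * apply is_derive_scal, (is_derive_plus (K := R_AbsRing) (V := R_NormedModule)).
      -- apply Derive.is_derive_mult.
         ++ apply (is_derive_line_Re _ _ _ _ _ D0).
         ++ apply (is_derive_line_Re _ _ _ _ _ D1).
      -- apply Derive.is_derive_mult.
         ++ apply (is_derive_line_Im _ _ _ _ _ D0).
         ++ apply (is_derive_line_Im _ _ _ _ _ D1).
    * apply is_derive_scal, is_derive_scal, (is_derive_plus (K := R_AbsRing) (V := R_NormedModule)).
      -- apply Derive.is_derive_mult; [apply (is_derive_line_Re _ _ _ _ _ D2) |].
         apply (is_derive_const (K := R_AbsRing) (V := R_NormedModule)).
      -- apply Derive.is_derive_mult; [apply (is_derive_line_Im _ _ _ _ _ D2) |].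
         apply (is_derive_const (K := R_AbsRing) (V := R_NormedModule)).
  + cbv beta. rewrite Hz0, Cmod2_alt.
    assert (Hu2 : Re u ^ 2 + Im u ^ 2 = 1) by (rewrite <- Cmod2_alt, Hu; ring).
    replace (u * RtoC 1)%C with u by ring.
    change (@plus R_AbsRing) with Rplus; change (@plus R_NormedModule) with Rplus.
    change (@zero R_NormedModule) with 0.
    transitivity (2 * (Re (u * P1 z) * Re (u * P1 z) + Re (P z) * Re (u * (u * P2)) +
    (Im (u * P1 z) * Im (u * P1 z) + Im (P z) * Im (u * (u * P2)))) + eps * (2 * (Re u ^ 2 + Im u ^ 2))).
    * ring.
    * rewrite Hu2; ring.
- assert (0 <= Cmod (u * P1 z) ^ 2) by apply pow2_ge_0. lra.
- exists (z + RtoC t * u)%C; split.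
  + replace (z + RtoC t * u - z)%C with (RtoC t * u)%C by ring.
    rewrite Cmod_mult, Cmod_R, Hu, Rmult_1_r.
    apply (Rlt_le_trans _ _ _ Ht1 (Rmin_l _ _)).
  + unfold phi in Ht2; rewrite Hz0 in Ht2; exact Ht2.
Qed.

Lemma list_argmax {T} (g : T -> R) (l : list T) :
  l <> nil -> exists t, In t l /\ forall s, In s l -> g s <= g t.
Proof.
induction l as [| a l IH]; [now intros [] |]; intros _.
destruct l as [| b l].
- exists a; split; [now left |]. intros s [-> | []]; lra.
- destruct IH as [t [Ht Hm]]; [discriminate |].
  destruct (Rle_dec (g a) (g t)) as [H | H].
  + exists t; split; [now right |]. intros s [<- | Hs]; [exact H | now apply Hm].
  + exists a; split; [now left |].
    intros s [<- | Hs]; [lra |]. specialize (Hm s Hs); lra.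
Qed.

(** An upper semicontinuous function attains its maximum on a closed disc.  If
    no point is maximal, every point has a neighbourhood dominated by the value at
    some other point of the disc; by compactness finitely many such values dominate
    the whole disc, including the largest of them. *)
Lemma disc_argmax (phi : C -> R) (rho : R) :
  0 <= rho ->
  (forall z, Cmod z <= rho -> forall e, 0 < e -> cnear z (fun y => phi y < phi z + e)) ->
  exists z, Cmod z <= rho /\ forall y, Cmod y <= rho -> phi y <= phi z.
Proof.
intros Hrho Hphi.
apply NNPP; intros Hno.
assert (Hbeat : forall z, Cmod z <= rho -> exists p, Cmod p <= rho /\ phi z < phi p).
{ intros z Hz; apply NNPP; intros H; apply Hno; exists z; split; [exact Hz |].
  intros y Hy; apply Rnot_lt_le; intros Hlt; apply H; now exists y. }
assert (Hloc : forall t : C, exists dp : posreal * C,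
  Cmod (snd dp) <= rho /\
  forall y, Cmod y <= rho -> Rabs (Re y - Re t) < fst dp -> Rabs (Im y - Im t) < fst dp ->
    phi y < phi (snd dp)).
{ intros t.
  assert (Hball : forall y r, Rabs (Re y - Re t) < r / 2 -> Rabs (Im y - Im t) < r / 2 ->
     Cmod (y - t) < r).
  { intros y r H1 H2.
    assert (Hy : (y - t)%C = (RtoC (Re y - Re t) + RtoC (Im y - Im t) * Ci)%C).
    { destruct y, t; apply injective_projections; simpl; ring. }
    rewrite Hy. eapply Rle_lt_trans; [apply Cmod_triangle |].
    rewrite Cmod_mult, !Cmod_R, Cmod_Ci. lra. }
  destruct (Rle_dec (Cmod t) rho) as [Ht | Ht].
  - destruct (Hbeat t Ht) as [p [Hp Hlt]].
    destruct (Hphi t Ht (phi p - phi t)) as [r [Hr H]]; [lra |].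
    assert (Hr2 : 0 < r / 2) by lra.
    exists (mkposreal _ Hr2, p); simpl; split; [exact Hp |].
    intros y _ H1 H2. specialize (H y (Hball y r H1 H2)); lra.
  (* off the disc, a neighbourhood that misses it makes the claim vacuous *)
  - assert (Hr2 : 0 < (Cmod t - rho) / 2) by lra.
    exists (mkposreal _ Hr2, RtoC 0); simpl; split; [now rewrite Cmod_0 |].
    intros y Hy H1 H2. specialize (Hball y _ H1 H2); exfalso.
    assert (Cmod t <= Cmod y + Cmod (y - t)); [| lra].
    replace t with (y + - (y - t))%C at 1 by ring.
    eapply Rle_trans; [apply Cmod_triangle | rewrite Cmod_opp; lra]. }
set (c := fun t => constructive_indefinite_description _ (Hloc t)).
set (toC := fun t : Compactness.Tn 2 R => let '(x, (y, _)) := t in (x, y) : C).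
apply (compactness_list 2 (- rho, (- rho, tt)) (rho, (rho, tt))
         (fun t => fst (proj1_sig (c (toC t))))).
intros [l Hl].
assert (Hl' : forall y : C, Cmod y <= rho -> exists t, In t l /\ phi y < phi (snd (proj1_sig (c (toC t))))).
{ intros [y1 y2] Hy.
  destruct (Hl (y1, (y2, tt))) as [[t1 [t2 []]] [Hin [_ Hcl]]].
  - assert (H1 := re_le_Cmod (y1, y2)); assert (H2 := im_le_Cmod (y1, y2)).
    simpl in *. 
    split; [| split; [| exact I]]; apply Rabs_le_between; lra.
  - exists (t1, (t2, tt)); split; [exact Hin |].
    destruct Hcl as [Hc1 [Hc2 _]].
    destruct (proj2_sig (c (toC (t1, (t2, tt))))) as [_ H].
    now apply H. }
destruct (list_argmax (fun t => phi (snd (proj1_sig (c (toC t))))) l) as [t [Ht Hmax]].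
{ intros ->. destruct (Hl' (RtoC 0)) as [? [[] _]]. now rewrite Cmod_0. }
destruct (proj2_sig (c (toC t))) as [Hp _].
destruct (Hl' _ Hp) as [s [Hs Hlt]]. specialize (Hmax s Hs). cbv beta in Hmax. lra.
Qed.

(** The origin is exempt from the regularity assumption because P vanishes there: a
    maximum of |P|^2 + eps |z|^2 at 0 has the value 0, below any bound.  Quotients by
    powers of z are then covered without a removable singularity theorem. *)
Lemma max_principle (P : C -> C) (rho M : R) :
  0 < rho -> 0 <= M -> P (RtoC 0) = RtoC 0 ->
  (forall z, Cmod z <= rho -> forall e, 0 < e -> cnear z (fun y => Cmod (P y - P z) < e)) ->
  (forall z, Cmod z < rho -> z <> RtoC 0 -> twice_cdiff P z) ->
  (forall z, Cmod z = rho -> Cmod (P z) <= M) ->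
  forall z, Cmod z <= rho -> Cmod (P z) <= M.
Proof.
intros Hrho HM HP0 Hcont Hdiff Hbd z Hz.
assert (Hkey : forall eps, 0 < eps -> Cmod (P z) ^ 2 <= M ^ 2 + eps).
{ intros eps0 Heps0. set (eps := eps0 / rho ^ 2).
  assert (Hr2 : 0 < rho ^ 2) by now apply pow_lt.
  assert (Heps : 0 < eps) by now apply Rdiv_lt_0_compat.
  assert (Hee : eps * rho ^ 2 = eps0) by (unfold eps; field; lra).
  destruct (disc_argmax (fun y => Cmod (P y) ^ 2 + eps * Cmod y ^ 2) rho) as [z0 [Hz0 Hmax]].
  - lra.
  - intros x Hx e He.
    set (A := Cmod (P x)) in *. set (B := Cmod x) in *.
    assert (HA : 0 <= A) by apply Cmod_ge_0.
    assert (HB : 0 <= B) by apply Cmod_ge_0.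
    set (q := Rmin 1 (e / (2 * (2 * A + 1)))).
    set (q' := Rmin 1 (e / (2 * (eps * (2 * B + 1))))).
    assert (Hq : 0 < q).
    { apply Rmin_pos; [lra |]. apply Rdiv_lt_0_compat; lra. }
    assert (Hq' : 0 < q').
    { apply Rmin_pos; [lra |]. apply Rdiv_lt_0_compat; [lra |].
      assert (0 < eps * (2 * B + 1)) by (apply Rmult_lt_0_compat; lra). lra. }
    assert (Hq1 : q * (2 * A + 1) <= e / 2).
    { replace (e / 2) with (e / (2 * (2 * A + 1)) * (2 * A + 1)) by (field; lra).
      apply Rmult_le_compat_r; [lra | apply Rmin_r]. }
    assert (Hq1' : eps * (q' * (2 * B + 1)) <= e / 2).
    { replace (e / 2) with (eps * (e / (2 * (eps * (2 * B + 1))) * (2 * B + 1))) by (field; lra).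
      apply Rmult_le_compat_l; [lra |].
      apply Rmult_le_compat_r; [lra | apply Rmin_r]. }
    assert (Hle1 : q <= 1) by apply Rmin_l.
    assert (Hle1' : q' <= 1) by apply Rmin_l.
    clearbody q q'.
    assert (Hid : cnear x (fun y => Cmod (y - x) < q')) by (exists q'; split; auto).
    eapply cnear_imp; [| apply (cnear_and _ _ _ (Hcont x Hx q Hq) Hid)].
    intros y [Hy1 Hy2].
    assert (H1 : Cmod (P y) < A + q).
    { replace (P y) with (P x + (P y - P x))%C by ring.
      eapply Rle_lt_trans; [apply Cmod_triangle |]. unfold A; lra. }
    assert (H2 : Cmod y < B + q').
    { replace y with (x + (y - x))%C by ring.
      eapply Rle_lt_trans; [apply Cmod_triangle |]. unfold B; lra. }
    assert (H1' := Cmod_ge_0 (P y)). assert (H2' := Cmod_ge_0 y).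
    assert (Cmod (P y) ^ 2 < A ^ 2 + q * (2 * A + 1)) by nra.
    assert (Cmod y ^ 2 < B ^ 2 + q' * (2 * B + 1)) by nra.
    assert (eps * Cmod y ^ 2 < eps * (B ^ 2 + q' * (2 * B + 1))) by (apply Rmult_lt_compat_l; lra).
    lra.
  - assert (Hmaxz := Hmax z Hz). cbv beta in Hmaxz.
    assert (0 <= eps * Cmod z ^ 2) by (apply Rmult_le_pos; [lra | apply pow2_ge_0]).
    assert (HM2 : 0 <= M ^ 2) by apply pow2_ge_0.
    destruct (Ceq_dec z0 (RtoC 0)) as [-> | Hn0].
    + rewrite HP0, Cmod_0 in Hmaxz. lra.
    + destruct Hz0 as [Hlt | Heq].
      * exfalso.
        destruct (strictly_subharmonic_not_max P z0 eps (rho - Cmod z0)) as [y [Hy1 Hy2]];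
          [now apply Hdiff | exact Heps | lra |].
        assert (Hy : Cmod y <= rho).
        { replace y with (z0 + (y - z0))%C by ring.
          eapply Rle_trans; [apply Cmod_triangle | lra]. }
        specialize (Hmax y Hy). cbv beta in Hmax. lra.
      * assert (Cmod (P z0) ^ 2 <= M ^ 2).
        { apply pow_incr; split; [apply Cmod_ge_0 | now apply Hbd]. }
        rewrite Heq in Hmaxz. lra. }
assert (Cmod (P z) ^ 2 <= M ^ 2) by (apply le_epsilon; exact Hkey).
apply Rnot_lt_le; intros Hlt. assert (H1 := Cmod_ge_0 (P z)). nra.
Qed.

(** * The Schwarz lemma *)

(** The function w^(n+1) / z^n is O(|z|) at 0 and at most 1 / rho^n in modulus on
    |z| = rho.  Hence |w|^(n+1) rho^n <= |z|^n inside; letting rho tend to 1 and n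
    to infinity excludes |w| > |z|. *)
Lemma Schwarz_lemma (w : C -> C) :
  (forall z, Delta z -> Delta (w z)) -> w (RtoC 0) = RtoC 0 ->
  analytic w -> (forall z, Delta z -> z <> RtoC 0 -> twice_cdiff w z) ->
  forall z, Delta z -> Cmod (w z) <= Cmod z.
Proof.
intros Hself Hw0 Han H2 z Hz.
destruct (Ceq_dec z (RtoC 0)) as [-> | Hz0]; [rewrite Hw0; lra |].
assert (Hs : 0 < Cmod z) by now apply Cmod_gt_0.
unfold Delta in *.
assert (Hkey : forall n rho, Cmod z <= rho < 1 -> Cmod (w z) ^ S n * rho ^ n <= Cmod z ^ n).
{ intros n rho [Hr1 Hr2].
  set (P := fun y => (w y ^ S n * / y ^ n)%C).
  assert (HPm : forall y, y <> RtoC 0 -> Cmod (P y) = Cmod (w y) ^ S n * / Cmod y ^ n).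
  { intros y Hy; unfold P.
    rewrite Cmod_mult, Cmod_inv, !Cmod_pow; [easy | now apply Cpow_nz]. }
  assert (HP0 : P (RtoC 0) = RtoC 0).
  { unfold P; rewrite Hw0; simpl; ring. }
  assert (Hdiff : forall y, Cmod y < 1 -> y <> RtoC 0 -> twice_cdiff P y).
  { intros y Hy Hy0; apply twice_cdiff_mult.
    - apply twice_cdiff_pow; now apply H2.
    - apply twice_cdiff_inv; [apply (twice_cdiff_pow (fun y => y)), twice_cdiff_id | now apply Cpow_nz]. }
  assert (Hbd : Cmod (P z) <= / rho ^ n).
  { apply (max_principle P rho); try assumption.
    - lra.
    - left; apply Rinv_0_lt_compat, pow_lt; lra.
    - intros y Hy e He.
      destruct (Ceq_dec y (RtoC 0)) as [-> | Hy0].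
      + destruct (Han (RtoC 0)) as [l Hl]; [unfold Delta; rewrite Cmod_0; lra |].
        apply is_cderive_eps with (eps := 1) in Hl; [| lra].
        set (B := (1 + Cmod l)).
        assert (HB : 0 < B) by (unfold B; assert (H := Cmod_ge_0 l); lra).
        assert (HBn : 0 < B ^ S n) by now apply pow_lt.
        assert (Hid : cnear (RtoC 0) (fun y => Cmod (y - 0) < e / B ^ S n)).
        { exists (e / B ^ S n); split; [now apply Rdiv_lt_0_compat | auto]. }
        eapply cnear_imp; [| apply (cnear_and _ _ _ Hl Hid)].
        intros y [Hy1 Hy2]. rewrite HP0, Hw0 in *.
        replace (y - 0)%C with y in * by ring.
        replace (P y - 0)%C with (P y) by ring.
        destruct (Ceq_dec y (RtoC 0)) as [-> | Hyn]; [now rewrite HP0, Cmod_0 |].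
        rewrite HPm by assumption.
        assert (Hm : 0 < Cmod y) by now apply Cmod_gt_0.
        assert (Hw : Cmod (w y) <= B * Cmod y).
        { replace (w y) with ((w y - 0 - y * l) + y * l)%C by ring.
          eapply Rle_trans; [apply Cmod_triangle |]. rewrite Cmod_mult; unfold B; lra. }
        apply Rle_lt_trans with (B ^ S n * Cmod y).
        * apply Rmult_le_reg_r with (Cmod y ^ n); [now apply pow_lt |].
          rewrite Rmult_assoc, Rinv_l by (apply Rgt_not_eq; now apply pow_lt).
          rewrite Rmult_1_r, Rmult_assoc.
          change (Cmod y * Cmod y ^ n) with (Cmod y ^ S n).
          rewrite <- Rpow_mult_distr.
          apply pow_incr; split; [apply Cmod_ge_0 | exact Hw].
        * apply Rmult_lt_compat_l with (r := B ^ S n) in Hy2; [| exact HBn].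
          replace (B ^ S n * (e / B ^ S n)) with e in Hy2 by (field; lra). exact Hy2.
      + destruct (Hdiff y) as [P1 [l1 [HP1 _]]]; [lra | exact Hy0 |].
        apply cnear_self in HP1. now apply (is_cderive_cont _ _ _ HP1).
    - intros y Hy; apply Hdiff; lra.
    - intros y Hy.
      assert (Hy0 : y <> RtoC 0) by (apply Cmod_gt_0; lra).
      rewrite HPm, Hy by assumption.
      rewrite <- (Rmult_1_l (/ rho ^ n)) at 2.
      apply Rmult_le_compat_r; [left; apply Rinv_0_lt_compat, pow_lt; lra |].
      rewrite <- (pow1 (S n)). apply pow_incr; split; [apply Cmod_ge_0 |].
      left; apply Hself; lra. }
  rewrite HPm in Hbd by assumption.
  assert (0 < rho ^ n) by (apply pow_lt; lra).
  assert (0 < Cmod z ^ n) by now apply pow_lt.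
  apply Rmult_le_compat_r with (r := Cmod z ^ n * rho ^ n) in Hbd; [| nra].
  replace (Cmod (w z) ^ S n * / Cmod z ^ n * (Cmod z ^ n * rho ^ n))
    with (Cmod (w z) ^ S n * rho ^ n) in Hbd by (field; lra).
  replace (/ rho ^ n * (Cmod z ^ n * rho ^ n)) with (Cmod z ^ n) in Hbd by (field; lra).
  exact Hbd. }
apply Rnot_lt_le; intros Hlt.
set (q := Cmod (w z)) in *. set (s := Cmod z) in *.
assert (Hsq : 0 < s / q < 1).
{ split; [apply Rdiv_lt_0_compat; lra |].
  apply Rmult_lt_reg_r with q; [lra |]. unfold Rdiv; rewrite Rmult_assoc, Rinv_l; lra. }
(* between the maximum of s and s/q, and 1: then q rho / s > 1 has unbounded powers *)
set (rho := (1 + Rmax s (s / q)) / 2).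
assert (Hm1 := Rmax_l s (s / q)). assert (Hm2 := Rmax_r s (s / q)).
assert (Hm : Rmax s (s / q) < 1) by (apply Rmax_lub_lt; lra).
assert (Hx : 1 < q * rho / s).
{ apply Rmult_lt_reg_r with s; [lra |].
  unfold Rdiv; rewrite Rmult_assoc, Rinv_l by lra.
  assert (s / q < rho) by (unfold rho; lra).
  apply Rmult_lt_compat_l with (r := q) in H; [| lra].
  replace (q * (s / q)) with s in H by (field; lra). lra. }
destruct (Pow_x_infinity (q * rho / s)) with (b := 2 / q) as [N HN].
{ rewrite Rabs_pos_eq; lra. }
specialize (HN N (Nat.le_refl _)).
specialize (Hkey N rho). assert (Hr : s <= rho < 1) by (unfold rho; lra).
specialize (Hkey Hr).
rewrite Rabs_pos_eq in HN by (apply pow_le; lra).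
apply Rge_le in HN.
assert (Hp : 0 < s ^ N) by now apply pow_lt.
assert (Hq0 : 0 < q) by lra.
assert (E : q ^ S N * rho ^ N = q * (q * rho / s) ^ N * s ^ N).
{ rewrite Rmult_assoc, <- Rpow_mult_distr.
  replace (q * rho / s * s) with (q * rho) by (field; lra).
  rewrite Rpow_mult_distr; simpl; ring. }
rewrite E in Hkey.
apply Rmult_le_compat_l with (r := q) in HN; [| lra].
replace (q * (2 / q)) with 2 in HN by (field; lra).
nra.
Qed.

(** * Power series on the unit disc *)

Notation is_cseries :=
  (is_series (K := C_AbsRing) (V := C_NormedModule)) (only parsing).
Notation is_cpseries :=
  (is_pseries (K := C_AbsRing) (V := C_NormedModule)) (only parsing).

Lemma pow_n_Cpow (z : C) n : pow_n (K := C_AbsRing) z n = (z ^ n)%C.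
Proof. induction n as [| n IH]; [reflexivity |].
exact (f_equal (Cmult z) IH). Qed.

Lemma is_cpseries_cseries (a : nat -> C) (z l : C) :
  is_cpseries a z l <-> is_cseries (fun k => z ^ k * a k)%C l.
Proof.
assert (E : forall k, scal (V := C_NormedModule) (pow_n (K := C_AbsRing) z k) (a k) = (z ^ k * a k)%C)
  by (intros k; exact (f_equal (fun x => Cmult x (a k)) (pow_n_Cpow z k))).
split; apply is_series_ext; intros k; [| symmetry]; apply E.
Qed.

Lemma is_cseries_unique (u : nat -> C) (l m : C) :
  is_cseries u l -> is_cseries u m -> l = m.
Proof. apply (filterlim_locally_unique (V := C_NormedModule)). Qed.

Lemma Cmod_series_le (u : nat -> C) (b : nat -> R) (l : C) (s : R) :
  is_cseries u l -> is_series b s -> (forall n, Cmod (u n) <= b n) -> Cmod l <= s.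
Proof.
intros Hu Hb Hle.
apply (is_lim_seq_le (fun n => Cmod (sum_n (G := C_AbelianMonoid) u n)) (sum_n b) (Cmod l) s).
- intros n.
  eapply Rle_trans; [apply (norm_sum_n_m (V := C_NormedModule)) |].
  apply sum_n_m_le; exact Hle.
- apply (filterlim_comp _ _ _ _ _ _ _ _ Hu (filterlim_norm (V := C_NormedModule) l)).
- exact Hb.
Qed.

(** Convergence on the unit disc is expressed through the real series of moduli,
    whose radius of convergence is unchanged by termwise differentiation. *)
Definition radius_ge_1 (a : nat -> C) : Prop :=
  Rbar_le 1 (CV_radius (fun n => Cmod (a n))).

Lemma radius_ge_1_bounded (a : nat -> C) :
  (forall r, 0 <= r < 1 -> exists M, forall n, Cmod (a n) * r ^ n <= M) -> radius_ge_1 a.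
Proof.
intros H. unfold radius_ge_1.
destruct (CV_radius_bounded (fun n => Cmod (a n))) as [Hub _].
assert (Hr : forall r, 0 <= r < 1 -> Rbar_le r (CV_radius (fun n => Cmod (a n)))).
{ intros r Hr. apply Hub. destruct (H r Hr) as [M HM]; exists M; intros n.
  rewrite Rabs_pos_eq; [apply HM |].
  apply Rmult_le_pos; [apply Cmod_ge_0 | apply pow_le; lra]. }
destruct (CV_radius (fun n => Cmod (a n))) as [c | |]; simpl in *; [| exact I |].
- apply Rnot_lt_le; intros Hc.
  assert (H0 := Hr 0 ltac:(lra)). specialize (Hr ((1 + c) / 2) ltac:(lra)). lra.
- exact (Hr 0 ltac:(lra)).
Qed.

(** The terms of a convergent series are bounded: by 1 beyond a Cauchy index and by
    a finite maximum before it. *)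
Lemma radius_ge_1_of_sum (a : nat -> C) (F : C -> C) :
  (forall z, Delta z -> is_cpseries a z (F z)) -> radius_ge_1 a.
Proof.
intros H; apply radius_ge_1_bounded; intros r Hr.
assert (Hd : Delta (RtoC r)) by (unfold Delta; rewrite Cmod_R, Rabs_pos_eq; lra).
specialize (H _ Hd). apply is_cpseries_cseries in H.
assert (HC := Cauchy_ex_series (V := C_CompleteNormedModule) _ (ex_intro _ _ H)).
destruct (HC (mkposreal 1 Rlt_0_1)) as [N HN]; simpl in HN.
destruct (list_argmax (fun n => Cmod (a n) * r ^ n) (List.seq 0 (S N))) as [n0 [_ Hn0]].
{ discriminate. }
exists (Rmax 1 (Cmod (a n0) * r ^ n0)); intros n.
destruct (Nat.le_gt_cases n N) as [Hn | Hn].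
- eapply Rle_trans; [| apply Rmax_r]. apply (Hn0 n), List.in_seq. lia.
- eapply Rle_trans; [| apply Rmax_l]. left.
  specialize (HN n n ltac:(lia) ltac:(lia)).
  rewrite sum_n_n in HN.
  change (Cmod (RtoC r ^ n * a n) < 1) in HN.
  rewrite Cmod_mult, Cmod_pow, Cmod_R, Rabs_pos_eq in HN by lra. lra.
Qed.

Lemma ex_cpseries_sum (a : nat -> C) :
  radius_ge_1 a -> exists F : C -> C, forall z, Delta z -> is_cpseries a z (F z).
Proof.
intros H. exists (fun z => epsilon (inhabits (RtoC 0)) (fun l => is_cpseries a z l)).
intros z Hz; apply epsilon_spec.
apply (ex_series_le (V := C_CompleteNormedModule) _
         (fun n => Rabs (Cmod (a n) * Cmod z ^ n))).
- intros n. change (Cmod (pow_n (K := C_AbsRing) z n * a n) <= Rabs (Cmod (a n) * Cmod z ^ n)).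
  rewrite pow_n_Cpow, Cmod_mult, Cmod_pow, Rmult_comm. apply Rle_abs.
- apply CV_disk_inside.
  eapply Rbar_lt_le_trans; [| exact H].
  simpl; rewrite Rabs_pos_eq by apply Cmod_ge_0. exact Hz.
Qed.

Definition deriv_coeffs (a : nat -> C) (n : nat) : C := (RtoC (INR (S n)) * a (S n))%C.

Lemma Cmod_deriv_coeffs a n :
  Cmod (deriv_coeffs a n) = PS_derive (fun k => Cmod (a k)) n.
Proof.
unfold deriv_coeffs, PS_derive.
rewrite Cmod_mult, Cmod_R, Rabs_pos_eq; [reflexivity | apply pos_INR].
Qed.

Lemma radius_ge_1_deriv a : radius_ge_1 a -> radius_ge_1 (deriv_coeffs a).
Proof.
unfold radius_ge_1; intros H.
now rewrite (CV_radius_ext _ _ (Cmod_deriv_coeffs a)), CV_radius_derive.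
Qed.

Lemma CV_radius_mult_INR (b : nat -> R) :
  CV_radius (fun n => INR n * b n) = CV_radius b.
Proof.
rewrite <- (CV_radius_derive b), <- (CV_radius_incr_1 (PS_derive b)).
apply CV_radius_ext; intros [| n]; [| reflexivity].
simpl; unfold zero; simpl; ring.
Qed.

(** Second-order remainder of y^n at z, by the recursion
    T_(n+1) = y T_n + n z^(n-1) (y - z)^2.  The factor r^2 on the left avoids the
    exponent n - 2, and n^2 replaces n (n - 1) / 2. *)
Lemma power_taylor_bound (y z : C) (r : R) (n : nat) :
  0 < r -> Cmod y <= r -> Cmod z <= r ->
  r ^ 2 * Cmod (y ^ n - z ^ n - (y - z) * (RtoC (INR n) * z ^ pred n))%C
    <= INR n ^ 2 * r ^ n * Cmod (y - z) ^ 2.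
Proof.
intros Hr Hy Hz.
assert (Hr2 : 0 < r ^ 2) by now apply pow_lt.
assert (HD := pow2_ge_0 (Cmod (y - z))).
induction n as [| n IH].
- replace (y ^ 0 - z ^ 0 - (y - z) * (RtoC (INR 0) * z ^ pred 0))%C with (RtoC 0)
    by (simpl; ring).
  rewrite Cmod_0; simpl; lra.
- set (T := (y ^ n - z ^ n - (y - z) * (RtoC (INR n) * z ^ pred n))%C) in *.
  assert (E : (y ^ S n - z ^ S n - (y - z) * (RtoC (INR (S n)) * z ^ pred (S n)))%C
     = (y * T + RtoC (INR n) * z ^ pred n * (y - z) ^ 2)%C).
  { unfold T. rewrite S_INR, RtoC_plus. simpl pred.
    destruct n as [| n]; simpl; ring. }
  rewrite E.
  assert (H1 : Cmod (y * T + RtoC (INR n) * z ^ pred n * (y - z) ^ 2)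
     <= r * Cmod T + INR n * r ^ pred n * Cmod (y - z) ^ 2).
  { eapply Rle_trans; [apply Cmod_triangle |].
    rewrite !Cmod_mult, !Cmod_pow, Cmod_R, (Rabs_pos_eq (INR n)) by apply pos_INR.
    apply Rplus_le_compat.
    - apply Rmult_le_compat_r; [apply Cmod_ge_0 | exact Hy].
    - apply Rmult_le_compat_r; [exact HD |].
      apply Rmult_le_compat_l; [apply pos_INR |].
      apply pow_incr; split; [apply Cmod_ge_0 | exact Hz]. }
  assert (H2 : r ^ 2 * (INR n * r ^ pred n) = INR n * r ^ S n).
  { destruct n as [| n]; simpl; ring. }
  apply Rmult_le_compat_l with (r := r ^ 2) in H1; [| lra].
  eapply Rle_trans; [apply H1 |].
  rewrite Rmult_plus_distr_l, <- (Rmult_assoc (r ^ 2)  (INR n * r ^ pred n)), H2.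
  apply Rmult_le_compat_l with (r := r) in IH; [| lra].
  replace (r ^ 2 * (r * Cmod T)) with (r * (r ^ 2 * Cmod T)) by ring.
  apply Rle_trans with (r * (INR n ^ 2 * r ^ n * Cmod (y - z) ^ 2)
     + INR n * r ^ S n * Cmod (y - z) ^ 2); [lra |].
  rewrite S_INR.
  assert (Hn := pos_INR n).
  assert (Hrn : 0 <= r ^ n * r * Cmod (y - z) ^ 2)
    by (apply Rmult_le_pos; [apply Rmult_le_pos; [apply pow_le |] |]; lra).
  replace (r ^ S n) with (r ^ n * r) by (simpl; ring).
  nra.
Qed.

(** Summing the Taylor remainders of the monomials bounds the remainder of F by
    |y - z|^2 r^(-2) sum n^2 |a_n| r^n, and the last series converges for r < 1. *)
Lemma is_cderive_pseries (a : nat -> C) (F G : C -> C) :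
  radius_ge_1 a ->
  (forall z, Delta z -> is_cpseries a z (F z)) ->
  (forall z, Delta z -> is_cpseries (deriv_coeffs a) z (G z)) ->
  forall z, Delta z -> is_cderive F z (G z).
Proof.
intros Ha HF HG z Hz. unfold Delta in *.
assert (Hz0 := Cmod_ge_0 z).
set (r := (1 + Cmod z) / 2).
assert (Hr : 0 < r < 1) by (unfold r; lra).
assert (Hsum : ex_series (fun n => INR n ^ 2 * Cmod (a n) * r ^ n)).
{ apply (ex_series_ext (fun n => Rabs (INR n * (INR n * Cmod (a n)) * r ^ n))).
  - intros n; rewrite Rabs_pos_eq; [simpl; ring |].
    apply Rmult_le_pos; [| apply pow_le; lra].
    repeat apply Rmult_le_pos; try apply pos_INR; apply Cmod_ge_0.
  - apply CV_disk_inside. rewrite !CV_radius_mult_INR.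
    eapply Rbar_lt_le_trans; [| exact Ha].
    simpl; rewrite Rabs_pos_eq; lra. }
destruct Hsum as [s Hs].
apply is_cderive_eps; intros eps Heps.
assert (Hs0 : 0 <= s).
{ rewrite <- Cmod_0. apply (Cmod_series_le (fun _ => RtoC 0) (fun n => INR n ^ 2 * Cmod (a n) * r ^ n)).
  - apply (filterlim_ext (fun _ => RtoC 0)).
    + intros n; symmetry. rewrite (sum_n_ext _ (fun _ => zero (G := C_AbelianMonoid))) by easy.
      apply (sum_n_m_const_zero (G := C_AbelianMonoid)).
    + apply filterlim_const.
  - exact Hs.
  - intros n; rewrite Cmod_0.
    apply Rmult_le_pos; [| apply pow_le; lra].
    apply Rmult_le_pos; [apply pow2_ge_0 | apply Cmod_ge_0]. }
assert (Hr2 : 0 < r ^ 2) by (apply pow_lt; lra).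
set (e := eps * r ^ 2 / (1 + s)).
assert (He : 0 < e) by (apply Rdiv_lt_0_compat; [nra | lra]).
exists (Rmin ((1 - Cmod z) / 2) e); split; [apply Rmin_pos; lra |].
intros y Hy.
assert (Hy1 := Rlt_le_trans _ _ _ Hy (Rmin_l _ _)).
assert (Hy2 := Rlt_le_trans _ _ _ Hy (Rmin_r _ _)).
assert (Hyr : Cmod y <= r).
{ replace y with (z + (y - z))%C by ring.
  eapply Rle_trans; [apply Cmod_triangle | unfold r; lra]. }
assert (HG' : is_cseries (fun n => RtoC (INR n) * z ^ pred n * a n)%C (G z)).
{ apply (is_series_decr_1 (V := C_NormedModule)).
  match goal with |- is_series _ ?l => replace l with (G z) end.
  - apply (is_series_ext (V := C_NormedModule) (fun k => z ^ k * deriv_coeffs a k)%C).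
    + intros n. unfold deriv_coeffs; simpl pred.
      match goal with |- ?x = ?y => change (@eq C x y) end. ring.
    + apply is_cpseries_cseries, HG; exact Hz.
  - match goal with |- ?x = ?y => change (@eq C x y) end.
    simpl INR. unfold plus, opp; simpl. ring. }
assert (Hser : is_cseries
  (fun n => (y ^ n - z ^ n - (y - z) * (RtoC (INR n) * z ^ pred n)) * a n)%C
  (F y - F z - (y - z) * G z)%C).
{ assert (H1 := proj1 (is_cpseries_cseries _ _ _) (HF y ltac:(lra))).
  assert (H2 := proj1 (is_cpseries_cseries _ _ _) (HF z Hz)).
  assert (H3 := is_series_minus (V := C_NormedModule) _ _ _ _
     (is_series_minus (V := C_NormedModule) _ _ _ _ H1 H2)
     (is_series_scal (V := C_NormedModule) (y - z)%C _ _ HG')).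
  refine (is_series_ext (V := C_NormedModule) _ _ _ _ H3).
  intros n. match goal with |- ?x = ?y => change (@eq C x y) end.
  unfold plus, opp, scal; simpl. unfold mult; simpl. ring. }
assert (Hb : Cmod (F y - F z - (y - z) * G z) <= Cmod (y - z) ^ 2 / r ^ 2 * s).
{ apply (Cmod_series_le _ _ _ _ Hser
    (is_series_scal (V := R_NormedModule) (Cmod (y - z) ^ 2 / r ^ 2) _ _ Hs)).
  intros n. rewrite Cmod_mult.
  assert (HT := power_taylor_bound y z r n (proj1 Hr) Hyr ltac:(unfold r; lra)).
  unfold scal; simpl; unfold mult; simpl.
  change (Cmod (y - z) * (Cmod (y - z) * 1)) with (Cmod (y - z) ^ 2).
  change (r * (r * 1)) with (r ^ 2).
  change (INR n * (INR n * 1)) with (INR n ^ 2).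
  set (T := Cmod (y ^ n - z ^ n - (y - z) * (RtoC (INR n) * z ^ pred n))) in *.
  replace (Cmod (y - z) ^ 2 / r ^ 2 * (INR n ^ 2 * Cmod (a n) * r ^ n))
    with (INR n ^ 2 * r ^ n * Cmod (y - z) ^ 2 / r ^ 2 * Cmod (a n)) by (field; lra).
  apply Rmult_le_compat_r; [apply Cmod_ge_0 |].
  apply Rmult_le_reg_l with (r ^ 2); [exact Hr2 |].
  replace (r ^ 2 * (INR n ^ 2 * r ^ n * Cmod (y - z) ^ 2 / r ^ 2))
    with (INR n ^ 2 * r ^ n * Cmod (y - z) ^ 2) by (field; lra).
  exact HT. }
eapply Rle_trans; [exact Hb |].
set (D := Cmod (y - z)) in *.
assert (HD : 0 <= D) by apply Cmod_ge_0.
apply Rmult_le_reg_l with (r ^ 2); [exact Hr2 |].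
replace (r ^ 2 * (D ^ 2 / r ^ 2 * s)) with (D * (D * s)) by (field; lra).
replace (r ^ 2 * (eps * D)) with (D * (eps * r ^ 2)) by ring.
apply Rmult_le_compat_l; [exact HD |].
apply Rle_trans with (e * (1 + s)); [nra |].
unfold e; right; field; lra.
Qed.

Lemma Delta_cnear z : Delta z -> cnear z Delta.
Proof.
unfold Delta; intros Hz; exists (1 - Cmod z); split; [lra |].
intros y Hy. replace y with (z + (y - z))%C by ring.
eapply Rle_lt_trans; [apply Cmod_triangle | lra].
Qed.

Lemma is_cpseries_0 (a : nat -> C) l : is_cpseries a (RtoC 0) l -> l = a O.
Proof.
intros H. assert (H0 := is_pseries_0 (K := C_AbsRing) (V := C_NormedModule) a).
exact (is_cseries_unique _ _ _ H H0).
Qed.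

Lemma Delta_0 : Delta (RtoC 0).
Proof. unfold Delta; rewrite Cmod_0; lra. Qed.

(** Three termwise differentiations; the existence of the third derivative is what
    makes z f' / f twice differentiable. *)
Lemma class_A_smooth (f : C -> C) :
  class_A f ->
  f (RtoC 0) = RtoC 0 /\
  exists f1 : C -> C, f1 (RtoC 0) = RtoC 1 /\
   forall z, Delta z -> is_cderive f z (f1 z) /\ twice_cdiff f z /\ twice_cdiff f1 z.
Proof.
intros [_ [a [Ha0 [Ha1 Hf]]]].
assert (R0 := radius_ge_1_of_sum _ _ Hf).
assert (R1 := radius_ge_1_deriv _ R0).
assert (R2 := radius_ge_1_deriv _ R1).
assert (R3 := radius_ge_1_deriv _ R2).
destruct (ex_cpseries_sum _ R1) as [f1 H1].
destruct (ex_cpseries_sum _ R2) as [f2 H2].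
destruct (ex_cpseries_sum _ R3) as [f3 H3].
assert (D1 := is_cderive_pseries _ _ _ R0 Hf H1).
assert (D2 := is_cderive_pseries _ _ _ R1 H1 H2).
assert (D3 := is_cderive_pseries _ _ _ R2 H2 H3).
split; [| exists f1; split].
- rewrite (is_cpseries_0 _ _ (Hf _ Delta_0)); exact Ha0.
- rewrite (is_cpseries_0 _ _ (H1 _ Delta_0)). unfold deriv_coeffs. rewrite Ha1; simpl. ring.
- intros z Hz; split; [now apply D1 | split].
  + exists f1, (f2 z); split; [| now apply D2].
    now apply (cnear_imp _ Delta); [| apply Delta_cnear].
  + exists f2, (f3 z); split; [| now apply D3].
    now apply (cnear_imp _ Delta); [| apply Delta_cnear].
Qed.

(** * The logarithmic derivative in the Booth class *)

(** The map of the unit disc onto the inside of a Booth lemniscate. *)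
Definition booth (alpha : R) (w : C) : C := (w / (1 - alpha * w ^ 2))%C.

Lemma Cmod_1_sub_ge (alpha s : R) (w : C) :
  0 < alpha < 1 -> Cmod w <= s -> 1 - alpha * s ^ 2 <= Cmod (1 - alpha * w ^ 2).
Proof.
intros Ha Hw. assert (H0 := Cmod_ge_0 w).
assert (H : 1 <= Cmod (1 - alpha * w ^ 2) + alpha * Cmod w ^ 2).
{ assert (T := Cmod_triangle (1 - alpha * w ^ 2) (alpha * w ^ 2)).
  replace ((1 - alpha * w ^ 2) + alpha * w ^ 2)%C with (RtoC 1) in T by ring.
  rewrite Cmod_1, (Cmod_mult alpha), Cmod_pow, Cmod_R, (Rabs_pos_eq alpha) in T by lra.
  exact T. }
assert (Cmod w ^ 2 <= s ^ 2) by (apply pow_incr; lra).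
nra.
Qed.

Lemma denominator_pos (alpha s : R) : 0 < alpha < 1 -> 0 <= s < 1 -> 0 < 1 - alpha * s ^ 2.
Proof. intros Ha Hs. assert (s ^ 2 < 1) by nra. nra. Qed.

Lemma denominator_neq0 (alpha : R) (w : C) :
  0 < alpha < 1 -> Delta w -> (1 - alpha * w ^ 2)%C <> RtoC 0.
Proof.
intros Ha Hw; apply Cmod_gt_0.
assert (H := Cmod_1_sub_ge alpha _ w Ha (Rle_refl _)).
assert (0 < 1 - alpha * Cmod w ^ 2); [| lra].
apply denominator_pos; [exact Ha | split; [apply Cmod_ge_0 | exact Hw]].
Qed.

Lemma Cmod_booth_le (alpha s : R) (w : C) :
  0 < alpha < 1 -> s < 1 -> Cmod w <= s ->
  Cmod (booth alpha w) <= s / (1 - alpha * s ^ 2).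
Proof.
intros Ha Hs Hw. assert (H0 := Cmod_ge_0 w).
unfold booth. rewrite Cmod_div by (apply denominator_neq0; [exact Ha | unfold Delta; lra]).
assert (Hd := denominator_pos alpha s Ha ltac:(lra)).
assert (H := Cmod_1_sub_ge alpha s w Ha Hw).
apply Rmult_le_compat; [exact H0 | left; apply Rinv_0_lt_compat; lra | exact Hw |].
apply Rinv_le_contravar; assumption.
Qed.

Lemma is_cderive_denominator (alpha : R) (w : C) :
  is_cderive (fun y => 1 - alpha * y ^ 2)%C w (- (2 * alpha * w))%C.
Proof.
apply (is_derive_ext (K := C_AbsRing) (V := C_NormedModule) (fun y => 1 - alpha * (y * y))%C).
{ intros t; match goal with |- ?x = ?y => change (@eq C x y) end. ring. }
eapply is_cderive_eq.
- apply is_cderive_minus; [apply is_cderive_const |].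
  apply is_cderive_mult; [apply is_cderive_const |].
  apply is_cderive_mult; apply is_cderive_id.
- cbv beta. ring.
Qed.

Lemma is_cderive_booth (alpha : R) (w : C) :
  0 < alpha < 1 -> Delta w ->
  is_cderive (booth alpha) w ((1 + alpha * w ^ 2) / (1 - alpha * w ^ 2) ^ 2)%C.
Proof.
intros Ha Hw. assert (Hd := denominator_neq0 _ _ Ha Hw).
eapply is_cderive_eq.
- apply is_cderive_mult; [apply is_cderive_id |].
  apply is_cderive_inv; [apply is_cderive_denominator | exact Hd].
- cbv beta. field. exact Hd.
Qed.

Lemma is_cderive_unique f (z l m : C) : is_cderive f z l -> is_cderive f z m -> l = m.
Proof.
intros H1 H2. now rewrite <- (is_C_derive_unique _ _ _ H1), <- (is_C_derive_unique _ _ _ H2).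
Qed.

Lemma neq0_cnear (z : C) : z <> RtoC 0 -> cnear z (fun y => y <> RtoC 0).
Proof. apply (is_cderive_neq0 (fun y => y) z _ (is_cderive_id z)). Qed.

Lemma analytic_is_cderive (f : C -> C) (z : C) :
  analytic f -> Delta z -> exists l : C, is_cderive f z l.
Proof. intros Hf Hz; destruct (Hf z Hz) as [l Hl]; now exists l. Qed.

(** From g = booth o w one gets w' = g' / booth'(w), and the right-hand side is
    differentiable where g' is, since w already is. *)
Lemma twice_cdiff_subordinating (alpha : R) (g w : C -> C) (z : C) :
  0 < alpha < 1 -> analytic w -> (forall y, Delta y -> Delta (w y)) ->
  (forall y, Delta y -> g y = booth alpha (w y)) ->
  Delta z -> twice_cdiff g z -> twice_cdiff w z.
Proof.
intros Ha Hw Hself Hg Hz [g1 [l [Hg1 Hl]]].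
assert (Hplus : forall v, Delta v -> (1 + alpha * v ^ 2)%C <> RtoC 0).
{ intros v Hv.
  (* a rotation by i reduces this to the denominator of booth *)
  replace (1 + alpha * v ^ 2)%C with (1 - alpha * (Ci * v) ^ 2)%C.
  - apply denominator_neq0; [exact Ha |]. unfold Delta. now rewrite Cmod_mult, Cmod_Ci, Rmult_1_l.
  - replace ((Ci * v) ^ 2)%C with (- v ^ 2)%C; [ring |].
    replace ((Ci * v) ^ 2)%C with ((Ci * Ci) * v ^ 2)%C by (simpl; ring).
    replace (Ci * Ci)%C with (- (1))%C by (apply injective_projections; simpl; ring). ring. }
exists (fun y => g1 y * ((1 - alpha * w y ^ 2) * (1 - alpha * w y ^ 2) * / (1 + alpha * w y ^ 2)))%C.
destruct (analytic_is_cderive w z Hw Hz) as [d Hd].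
eexists; split.
- eapply cnear_imp; [| apply (cnear_and _ _ _ Hg1 (cnear_cnear _ _ (Delta_cnear _ Hz)))].
  intros y [Hy1 Hy2]. assert (HyD := cnear_self _ _ Hy2).
  destruct (analytic_is_cderive w y Hw HyD) as [e He].
  assert (Hc := is_cderive_comp _ w y _ e (is_cderive_booth alpha (w y) Ha (Hself _ HyD)) He).
  assert (Hc' : is_cderive g y (e * ((1 + alpha * w y ^ 2) / (1 - alpha * w y ^ 2) ^ 2))%C).
  { eapply is_cderive_near_ext; [| exact Hc].
    eapply cnear_imp; [| exact Hy2]. intros x Hx; symmetry; now apply Hg. }
  eapply is_cderive_eq; [exact He |].
  rewrite (is_cderive_unique _ _ _ _ Hy1 Hc').
  assert (H1 := denominator_neq0 _ _ Ha (Hself _ HyD)).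
  assert (H2 := Hplus _ (Hself _ HyD)).
  match goal with |- ?x = ?y => change (@eq C x y) end.
  field. split; assumption.
- apply is_cderive_mult; [exact Hl |].
  assert (Hden : is_cderive (fun y => 1 - alpha * w y ^ 2)%C z (d * - (2 * alpha * w z))%C)
    by apply (is_cderive_comp _ w z _ d (is_cderive_denominator alpha (w z)) Hd).
  apply is_cderive_mult; [apply is_cderive_mult; exact Hden |].
  apply is_cderive_inv; [| apply Hplus, Hself, Hz].
  apply is_cderive_near_ext with (f := fun y => (2 - (1 - alpha * w y ^ 2))%C).
  + exists 1; split; [lra |]; intros y _. ring.
  + apply is_cderive_minus; [apply is_cderive_const | exact Hden].
Qed.

Lemma BS_zdlog_bound (alpha : R) (f : C -> C) :
  0 < alpha < 1 -> BS alpha f ->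
  forall z, Delta z -> Cmod (zdlog f z - 1) <= Cmod z / (1 - alpha * Cmod z ^ 2).
Proof.
intros Ha [HA [Hf0 [Hg [_ [w [Hw [Hself [Hw0 Heq]]]]]]]] z Hz.
destruct (class_A_smooth f HA) as [Hf00 [f1 [_ Hf1]]].
rewrite Heq by exact Hz.
apply Cmod_booth_le; [exact Ha | exact Hz |].
apply Schwarz_lemma; try assumption.
clear z Hz; intros z Hz Hz0.
apply (twice_cdiff_subordinating alpha (fun y => zdlog f y - 1)%C w z); try assumption.
destruct (Hf1 z Hz) as [_ [T0 T1]].
apply twice_cdiff_near_ext with (f := fun y => (y * f1 y * / f y - 1)%C).
- eapply cnear_imp; [| apply (cnear_and _ _ _ (Delta_cnear _ Hz) (neq0_cnear _ Hz0))].
  intros y [Hy Hy0]. unfold zdlog.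
  destruct (Ceq_dec y (RtoC 0)) as [E | _]; [contradiction |].
  now rewrite (is_C_derive_unique _ _ _ (proj1 (Hf1 y Hy))).
- apply twice_cdiff_minus; [| apply twice_cdiff_const].
  apply twice_cdiff_mult; [| apply twice_cdiff_inv; [exact T0 | now apply Hf0]].
  apply twice_cdiff_mult; [apply twice_cdiff_id | exact T1].
Qed.

(** * The bounding function on the real axis *)

(** The primitive of 1 / (1 - alpha t^2) that vanishes at 0, that is
    log (fhat(t) / t). *)
Definition log_growth (alpha t : R) : R :=
  ln ((1 + t * sqrt alpha) / (1 - t * sqrt alpha)) / (2 * sqrt alpha).

Lemma sqrt_bounds (alpha t : R) : 0 < alpha < 1 -> -1 < t < 1 ->
  0 < sqrt alpha /\ sqrt alpha ^ 2 = alpha /\ 0 < 1 + t * sqrt alpha /\ 0 < 1 - t * sqrt alpha.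
Proof.
intros Ha Ht.
assert (H0 : 0 < sqrt alpha) by (apply sqrt_lt_R0; lra).
assert (H2 : sqrt alpha ^ 2 = alpha) by (apply pow2_sqrt; lra).
assert (sqrt alpha < 1) by nra.
repeat split; try assumption; nra.
Qed.

Lemma is_derive_log_growth (alpha t : R) : 0 < alpha < 1 -> -1 < t < 1 ->
  is_derive (log_growth alpha) t (/ (1 - alpha * t ^ 2)).
Proof.
intros Ha Ht. destruct (sqrt_bounds alpha t Ha Ht) as [H0 [H2 [H3 H4]]].
unfold log_growth. auto_derive.
- repeat split; try lra. apply Rmult_lt_0_compat; [lra | now apply Rinv_0_lt_compat].
- set (s := sqrt alpha) in *. clearbody s. rewrite <- H2. field.
  assert (1 - s ^ 2 * t ^ 2 = (1 + t * s) * (1 - t * s)) by ring.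
  assert (0 < (1 + t * s) * (1 - t * s)) by now apply Rmult_lt_0_compat.
  repeat split; lra.
Qed.

Lemma log_growth_opp (alpha t : R) : 0 < alpha < 1 -> -1 < t < 1 ->
  log_growth alpha (- t) = - log_growth alpha t.
Proof.
intros Ha Ht. destruct (sqrt_bounds alpha t Ha Ht) as [H0 [H2 [H3 H4]]].
unfold log_growth.
replace ((1 + - t * sqrt alpha) / (1 - - t * sqrt alpha))
  with (/ ((1 + t * sqrt alpha) / (1 - t * sqrt alpha))) by (field; lra).
rewrite ln_Rinv; [field; lra |].
now apply Rdiv_lt_0_compat.
Qed.

Lemma Arg_pos (x : R) : 0 < x -> Arg (RtoC x) = 0.
Proof.
intros Hx. unfold Arg. simpl.
destruct (Rle_dec 0 0) as [_ | H]; [| lra].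
rewrite Cmod_R, Rabs_pos_eq by lra.
replace (x / x) with 1 by (field; lra). apply acos_1.
Qed.

(** On ]-1, 1[ the base of the power is a positive real, so its argument is 0 and the
    principal branch is the real power. *)
Lemma fhat_real (alpha t : R) : 0 < alpha < 1 -> -1 < t < 1 ->
  fhat alpha (RtoC t) = RtoC (t * exp (log_growth alpha t)).
Proof.
intros Ha Ht. destruct (sqrt_bounds alpha t Ha Ht) as [H0 [H2 [H3 H4]]].
unfold fhat.
replace ((1 + RtoC t * RtoC (sqrt alpha)) / (1 - RtoC t * RtoC (sqrt alpha)))%C
  with (RtoC ((1 + t * sqrt alpha) / (1 - t * sqrt alpha))).
2:{ rewrite RtoC_div by lra. now rewrite RtoC_plus, RtoC_minus, RtoC_mult. }
replace (1 / (2 * RtoC (sqrt alpha)))%C with (RtoC (1 / (2 * sqrt alpha))).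
2:{ rewrite RtoC_div by lra. now rewrite RtoC_mult. }
assert (Hq : 0 < (1 + t * sqrt alpha) / (1 - t * sqrt alpha)) by now apply Rdiv_lt_0_compat.
unfold Cpower, Clog. rewrite Arg_pos, Cmod_R, Rabs_pos_eq by lra.
unfold log_growth. set (L := ln _).
assert (E : (RtoC (1 / (2 * sqrt alpha)) * (L, 0))%C = RtoC (L / (2 * sqrt alpha))).
{ apply injective_projections; simpl; field; lra. }
rewrite E. unfold Cexp. simpl Re; simpl Im. rewrite cos_0, sin_0.
apply injective_projections; simpl; ring.
Qed.

(** * Radial growth *)

Lemma nonpos_of_derive_nonpos (m m' : R -> R) (r : R) :
  0 < r -> (forall t, 0 < t <= r -> is_derive m t (m' t)) ->
  (forall t, 0 < t <= r -> m' t <= 0) ->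
  (forall e, 0 < e -> exists d, 0 < d /\ forall t, 0 < t < d -> m t < e) ->
  m r <= 0.
Proof.
intros Hr Hd Hneg Hlim.
apply le_epsilon; intros e He. rewrite Rplus_0_l.
destruct (Hlim e He) as [d [Hd0 Hde]].
set (t := Rmin r d / 2).
assert (Ht : 0 < t /\ t < r /\ t < d).
{ assert (H1 := Rmin_l r d); assert (H2 := Rmin_r r d).
  assert (0 < Rmin r d) by now apply Rmin_pos. unfold t; lra. }
destruct (MVT_cor2 m m' t r) as [x [Hx1 Hx2]]; [lra | |].
{ intros x Hx; apply is_derive_Reals, Hd; lra. }
specialize (Hneg x ltac:(lra)). specialize (Hde t ltac:(lra)). nra.
Qed.

Lemma continuity_eps (f : R -> R) (x : R) : continuity_pt f x ->
  forall e, 0 < e -> exists d, 0 < d /\ forall y, Rabs (y - x) < d -> Rabs (f y - f x) < e.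
Proof.
intros H e He. destruct (H e He) as [d [Hd Hy]]; exists d; split; [exact Hd |].
intros y Hyx. destruct (Req_dec y x) as [-> | Hn].
- unfold Rminus; rewrite Rplus_opp_r, Rabs_R0; exact He.
- apply Hy; split; [split; [exact I | congruence] | exact Hyx].
Qed.

Section RadialGrowth.

Variables (f f1 : C -> C).
Hypothesis f_0 : f (RtoC 0) = RtoC 0.
Hypothesis f1_0 : f1 (RtoC 0) = RtoC 1.
Hypothesis f_neq0 : forall z, Delta z -> z <> RtoC 0 -> f z <> RtoC 0.
Hypothesis f_der : forall z, Delta z -> is_cderive f z (f1 z).

(** log |f| is half the logarithm of |f|^2, whose derivative along the ray is
    2 Re (conj f * u f'). *)
Lemma is_derive_ln_Cmod_ray (u : C) (t : R) : Cmod u = 1 -> 0 < t < 1 ->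
  is_derive (fun s => ln (Cmod (f (RtoC s * u)%C)) - ln s) t
    ((Re (zdlog f (RtoC t * u)%C) - 1) / t).
Proof.
intros Hu Ht.
assert (Hm : Cmod (RtoC t * u)%C = t) by (rewrite Cmod_mult, Cmod_R, Hu, Rabs_pos_eq; lra).
assert (HD : Delta (RtoC t * u)%C) by (unfold Delta; lra).
assert (Hn0 : (RtoC t * u)%C <> RtoC 0) by (apply Cmod_gt_0; lra).
assert (Hf0 := f_neq0 _ HD Hn0). assert (Hfpos := proj1 (Cmod_gt_0 _) Hf0).
set (y := (RtoC t * u)%C) in *.
assert (Hd : is_cderive f (RtoC 0 + RtoC t * u)%C (f1 y)).
{ replace (RtoC 0 + RtoC t * u)%C with y by (unfold y; ring). now apply f_der. }
assert (H2 := is_derive_line_Cmod2 f (RtoC 0) u _ t Hd).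
assert (H3 : is_derive (fun s => Cmod (f (RtoC s * u)%C) ^ 2) t
   (2 * (Re (f y) * Re (u * f1 y)%C + Im (f y) * Im (u * f1 y)%C))).
{ replace (RtoC 0 + RtoC t * u)%C with y in H2 by (unfold y; ring).
  eapply is_derive_ext; [| exact H2].
  intros s; cbv beta. now replace (RtoC 0 + RtoC s * u)%C with (RtoC s * u)%C by ring. }
assert (Hpos2 : 0 < Cmod (f y) ^ 2) by now apply pow_lt.
assert (Hln : is_derive (fun s => / 2 * ln (Cmod (f (RtoC s * u)%C) ^ 2)) t
   (/ 2 * (2 * (Re (f y) * Re (u * f1 y)%C + Im (f y) * Im (u * f1 y)%C) * / Cmod (f y) ^ 2))).
{ apply is_derive_scal.
  apply (is_derive_comp (K := R_AbsRing) (V := R_NormedModule) ln (fun s => Cmod (f (RtoC s * u)%C) ^ 2)).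
  - now apply is_derive_ln.
  - exact H3. }
assert (Hlnt : is_derive ln t (/ t)) by (apply is_derive_ln; lra).
assert (Hz : Re (zdlog f y) / t
   = (Re (f y) * Re (u * f1 y)%C + Im (f y) * Im (u * f1 y)%C) / Cmod (f y) ^ 2).
{ unfold zdlog. destruct (Ceq_dec y (RtoC 0)) as [E | _]; [contradiction |].
  rewrite (is_C_derive_unique _ _ _ (f_der _ HD)).
  replace (y * f1 y / f y)%C with (RtoC t * ((u * f1 y) / f y))%C by (unfold y; field; exact Hf0).
  rewrite re_scal_l, Cmod2_alt. rewrite Cmod2_alt in Hpos2.
  destruct (u * f1 y)%C as [p1 p2]. destruct (f y) as [q1 q2]. simpl in *.
  field. lra. }
eapply is_derive_eq.
- apply (is_derive_ext_loc (K := R_AbsRing) (V := R_NormedModule)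
    (fun s => minus (/ 2 * ln (Cmod (f (RtoC s * u)%C) ^ 2)) (ln s))).
  + assert (Hr : 0 < Rmin t (1 - t)) by (apply Rmin_pos; lra).
    exists (mkposreal _ Hr). intros s Hs. 
    change (Rabs (s - t) < Rmin t (1 - t)) in Hs.
    assert (H4 := Rlt_le_trans _ _ _ Hs (Rmin_l _ _)).
    assert (H5 := Rlt_le_trans _ _ _ Hs (Rmin_r _ _)).
    apply Rabs_def2 in H4. apply Rabs_def2 in H5.
    assert (Hms : Cmod (RtoC s * u)%C = s) by (rewrite Cmod_mult, Cmod_R, Hu, Rabs_pos_eq; lra).
    assert (0 < Cmod (f (RtoC s * u)%C)).
    { apply Cmod_gt_0, f_neq0; [unfold Delta; lra | apply Cmod_gt_0; lra]. }
    change (/ 2 * ln (Cmod (f (RtoC s * u)%C) ^ 2) - ln s = ln (Cmod (f (RtoC s * u)%C)) - ln s).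
    rewrite ln_pow by assumption. simpl INR. lra.
  + apply (is_derive_minus (K := R_AbsRing) (V := R_NormedModule)); [exact Hln | exact Hlnt].
- transitivity (Re (zdlog f y) / t - / t); [rewrite Hz | field; lra].
  match goal with |- minus ?a ?b = _ => change (a - b = (Re (f y) * Re (u * f1 y)%C + Im (f y) * Im (u * f1 y)%C) / Cmod (f y) ^ 2 - / t) end.
  field. lra.
Qed.

Lemma ln_Cmod_ray_0 (u : C) : Cmod u = 1 -> forall e, 0 < e -> exists d, 0 < d <= 1 /\
  forall t, 0 < t < d -> Rabs (ln (Cmod (f (RtoC t * u)%C)) - ln t) < e.
Proof.
intros Hu e He.
destruct (continuity_eps ln 1) with (e := e) as [d1 [Hd1 Hln]]; [| exact He |].
{ apply derivable_continuous_pt; exists (/ 1). apply derivable_pt_lim_ln; lra. }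
destruct (proj1 (is_cderive_eps _ _ _) (f_der _ Delta_0) (d1 / 2)) as [d2 [Hd2 Hf]]; [lra |].
exists (Rmin 1 d2); split; [split; [apply Rmin_pos; lra | apply Rmin_l] |].
intros t Ht. assert (H1 := Rmin_l 1 d2). assert (H2 := Rmin_r 1 d2).
assert (Hm : Cmod (RtoC t * u)%C = t) by (rewrite Cmod_mult, Cmod_R, Hu, Rabs_pos_eq; lra).
assert (HD : Delta (RtoC t * u)%C) by (unfold Delta; lra).
assert (Hn0 : (RtoC t * u)%C <> RtoC 0) by (apply Cmod_gt_0; lra).
assert (Hfpos := proj1 (Cmod_gt_0 _) (f_neq0 _ HD Hn0)).
set (y := (RtoC t * u)%C) in *.
specialize (Hf y). rewrite f_0, f1_0 in Hf.
replace (y - 0)%C with y in Hf by ring.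
replace (f y - 0 - y * 1)%C with (f y - y)%C in Hf by ring.
rewrite Hm in Hf. specialize (Hf ltac:(lra)).
rewrite <- ln_div by lra.
rewrite <- (Rminus_0_r (ln _)), <- ln_1. apply Hln.
replace (Cmod (f y) / t - 1) with ((Cmod (f y) - t) / t) by (field; lra).
unfold Rdiv; rewrite Rabs_mult, Rabs_inv, (Rabs_pos_eq t) by lra.
apply Rle_lt_trans with (d1 / 2 * t * / t); [| replace (d1 / 2 * t * / t) with (d1 / 2) by (field; lra); lra].
apply Rmult_le_compat_r; [left; apply Rinv_0_lt_compat; lra |].
assert (T1 : Cmod (f y) <= t + Cmod (f y - y)).
{ rewrite <- Hm. replace (f y) with (y + (f y - y))%C at 1 by ring. apply Cmod_triangle. }
assert (T2 : t <= Cmod (f y) + Cmod (f y - y)).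
{ rewrite <- Hm at 1. replace y with (f y + - (f y - y))%C at 1 by ring.
  rewrite <- (Cmod_opp (f y - y)). apply Cmod_triangle. }
apply Rabs_le; lra.
Qed.

(** tau = 1 and tau = -1 give the upper and the lower estimate; sigma is the sign of
    the comparison function.  The difference of the two sides is monotone in r and
    tends to 0 with r. *)
Lemma radial_comparison (alpha r sigma tau : R) (u : C) :
  0 < alpha < 1 -> 0 < r < 1 -> Cmod u = 1 ->
  (forall t, 0 < t <= r ->
     tau * (Re (zdlog f (RtoC t * u)%C) - 1) <= tau * (sigma * (t / (1 - alpha * t ^ 2)))) ->
  tau * (ln (Cmod (f (RtoC r * u)%C)) - ln r) <= tau * (sigma * log_growth alpha r).
Proof.
intros Ha Hr Hu Hle.
set (L := fun t => ln (Cmod (f (RtoC t * u)%C)) - ln t).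
set (m := fun t => tau * (L t - sigma * log_growth alpha t)).
assert (Hm : m r <= 0); [| unfold m, L in Hm; lra].
apply (nonpos_of_derive_nonpos m
  (fun t => tau * ((Re (zdlog f (RtoC t * u)%C) - 1) / t - sigma * / (1 - alpha * t ^ 2)))).
- lra.
- intros t Ht. apply is_derive_scal.
  apply (is_derive_minus (K := R_AbsRing) (V := R_NormedModule)).
  + apply is_derive_ln_Cmod_ray; [exact Hu | lra].
  + apply is_derive_scal, is_derive_log_growth; [exact Ha | lra].
- intros t Ht. specialize (Hle t Ht).
  assert (Hd := denominator_pos alpha t Ha ltac:(lra)).
  apply Rmult_le_reg_l with t; [lra |].
  rewrite Rmult_0_r.
  replace (t * (tau * ((Re (zdlog f (RtoC t * u)%C) - 1) / t - sigma * / (1 - alpha * t ^ 2))))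
    with (tau * (Re (zdlog f (RtoC t * u)%C) - 1) - tau * (sigma * (t / (1 - alpha * t ^ 2)))) by (field; lra).
  lra.
- intros e He.
  set (B := (1 + Rabs tau) * (1 + Rabs sigma)).
  assert (Htau := Rabs_pos tau). assert (Hsig := Rabs_pos sigma).
  assert (HB : 0 < B) by (unfold B; apply Rmult_lt_0_compat; lra).
  set (e' := e / (2 * B)).
  assert (He' : 0 < e') by (apply Rdiv_lt_0_compat; lra).
  destruct (ln_Cmod_ray_0 u Hu e' He') as [d1 [Hd1 H1]].
  destruct (continuity_eps (log_growth alpha) 0) with (e := e') as [d2 [Hd2 H2]]; [| exact He' |].
  { apply derivable_continuous_pt; eexists. apply is_derive_Reals, is_derive_log_growth; lra. }
  exists (Rmin d1 d2); split; [apply Rmin_pos; lra |].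
  intros t Ht. assert (H3 := Rmin_l d1 d2). assert (H4 := Rmin_r d1 d2).
  specialize (H1 t ltac:(lra)). fold (L t) in H1.
  specialize (H2 t). rewrite Rminus_0_r, (Rabs_pos_eq t) in H2 by lra.
  specialize (H2 ltac:(lra)).
  assert (K0 : log_growth alpha 0 = 0).
  { unfold log_growth. replace ((1 + 0 * sqrt alpha) / (1 - 0 * sqrt alpha)) with 1 by field.
    rewrite ln_1. unfold Rdiv; ring. }
  rewrite K0, Rminus_0_r in H2.
  unfold m. eapply Rle_lt_trans; [apply Rle_abs |].
  rewrite Rabs_mult.
  assert (Hs : Rabs (L t - sigma * log_growth alpha t) <= e' * (1 + Rabs sigma)).
  { unfold Rminus. eapply Rle_trans; [apply Rabs_triang |].
    rewrite Rabs_Ropp, Rabs_mult. nra. }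
  apply Rle_lt_trans with (e' * B); [unfold B |].
  + apply Rle_trans with (Rabs tau * (e' * (1 + Rabs sigma))).
    * now apply Rmult_le_compat_l.
    * assert (0 <= e' * (1 + Rabs sigma)) by (apply Rmult_le_pos; lra). nra.
  + unfold e'. replace (e / (2 * B) * B) with (e / 2) by (field; lra). lra.
Qed.

Lemma Cmod_ray_le (alpha r sigma : R) (u : C) :
  0 < alpha < 1 -> 0 < r < 1 -> Cmod u = 1 ->
  (forall t, 0 < t <= r ->
     Re (zdlog f (RtoC t * u)%C) - 1 <= sigma * (t / (1 - alpha * t ^ 2))) ->
  Cmod (f (RtoC r * u)%C) <= r * exp (sigma * log_growth alpha r).
Proof.
intros Ha Hr Hu Hle.
assert (H := radial_comparison alpha r sigma 1 u Ha Hr Hu).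
assert (Hm : Cmod (RtoC r * u)%C = r) by (rewrite Cmod_mult, Cmod_R, Hu, Rabs_pos_eq; lra).
assert (Hfpos : 0 < Cmod (f (RtoC r * u)%C)).
{ apply Cmod_gt_0, f_neq0; [unfold Delta; lra | apply Cmod_gt_0; lra]. }
rewrite !Rmult_1_l in H.
assert (H' : ln (Cmod (f (RtoC r * u)%C)) <= ln r + sigma * log_growth alpha r).
{ cut (ln (Cmod (f (RtoC r * u)%C)) - ln r <= sigma * log_growth alpha r); [lra |].
  apply H. intros t Ht. rewrite !Rmult_1_l. now apply Hle. }
rewrite <- (exp_ln _ Hfpos).
replace (r * exp (sigma * log_growth alpha r)) with (exp (ln r + sigma * log_growth alpha r))
  by (rewrite exp_plus, exp_ln by lra; reflexivity).
destruct H' as [H' | ->]; [left; now apply exp_increasing | right; reflexivity].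
Qed.

Lemma Cmod_ray_ge (alpha r sigma : R) (u : C) :
  0 < alpha < 1 -> 0 < r < 1 -> Cmod u = 1 ->
  (forall t, 0 < t <= r ->
     sigma * (t / (1 - alpha * t ^ 2)) <= Re (zdlog f (RtoC t * u)%C) - 1) ->
  r * exp (sigma * log_growth alpha r) <= Cmod (f (RtoC r * u)%C).
Proof.
intros Ha Hr Hu Hle.
assert (H := radial_comparison alpha r sigma (-1) u Ha Hr Hu).
assert (Hm : Cmod (RtoC r * u)%C = r) by (rewrite Cmod_mult, Cmod_R, Hu, Rabs_pos_eq; lra).
assert (Hfpos : 0 < Cmod (f (RtoC r * u)%C)).
{ apply Cmod_gt_0, f_neq0; [unfold Delta; lra | apply Cmod_gt_0; lra]. }
assert (H' : ln r + sigma * log_growth alpha r <= ln (Cmod (f (RtoC r * u)%C))).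
{ cut (-1 * (ln (Cmod (f (RtoC r * u)%C)) - ln r) <= -1 * (sigma * log_growth alpha r)); [lra |].
  apply H. intros t Ht. specialize (Hle t Ht); lra. }
rewrite <- (exp_ln _ Hfpos).
replace (r * exp (sigma * log_growth alpha r)) with (exp (ln r + sigma * log_growth alpha r))
  by (rewrite exp_plus, exp_ln by lra; reflexivity).
destruct H' as [H' | ->]; [left; now apply exp_increasing | right; reflexivity].
Qed.

End RadialGrowth.

Lemma BS_growth (alpha : R) (f : C -> C) (z : C) :
  0 < alpha < 1 -> BS alpha f -> 0 < Cmod z < 1 ->
  Cmod z * exp (- log_growth alpha (Cmod z)) <= Cmod (f z)
    <= Cmod z * exp (log_growth alpha (Cmod z)).
Proof.
intros Ha HB Hz.
assert (Hbd := BS_zdlog_bound alpha f Ha HB).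
destruct HB as [HA [Hf0 _]].
destruct (class_A_smooth f HA) as [Hf00 [f1 [Hf10 Hf1]]].
set (r := Cmod z) in *. set (u := (z / RtoC r)%C).
assert (Hr0 : RtoC r <> RtoC 0) by (apply Cmod_gt_0; rewrite Cmod_R, Rabs_pos_eq; lra).
assert (Hu : Cmod u = 1).
{ unfold u. rewrite Cmod_div, Cmod_R, Rabs_pos_eq by (try assumption; lra). unfold r; field.
  unfold r in Hz; lra. }
assert (Hzu : z = (RtoC r * u)%C) by (unfold u; field; exact Hr0).
assert (Hre : forall t, 0 < t <= r ->
  - (t / (1 - alpha * t ^ 2)) <= Re (zdlog f (RtoC t * u)%C) - 1 <= t / (1 - alpha * t ^ 2)).
{ intros t Ht.
  assert (Hm : Cmod (RtoC t * u)%C = t) by (rewrite Cmod_mult, Cmod_R, Hu, Rabs_pos_eq; lra).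
  assert (H := Hbd (RtoC t * u)%C ltac:(unfold Delta; lra)). rewrite Hm in H.
  assert (H1 := re_le_Cmod (zdlog f (RtoC t * u)%C - 1)%C).
  unfold Cminus in H1; rewrite re_plus, re_opp, re_RtoC in H1.
  apply Rabs_le_between. unfold Cminus in H. eapply Rle_trans; [exact H1 | exact H]. }
assert (Hder : forall y, Delta y -> is_cderive f y (f1 y)) by (intros y Hy; now apply Hf1).
rewrite Hzu. split.
- replace (- log_growth alpha r) with (-1 * log_growth alpha r) by ring.
  apply (Cmod_ray_ge f f1); try assumption.
  intros t Ht; specialize (Hre t Ht); lra.
- replace (log_growth alpha r) with (1 * log_growth alpha r) by ring.
  apply (Cmod_ray_le f f1); try assumption.
  intros t Ht; specialize (Hre t Ht); lra.
Qed.

(** * The extremal function *)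

(** The Taylor coefficients of the solution of (1 - alpha z^2) F' = F, F(0) = 1,
    satisfy (n + 2) c_(n+2) = c_(n+1) + alpha n c_n; the pair (c_n, c_(n+1)) turns
    this into a structural recursion. *)
Fixpoint extremal_pair (alpha : R) (n : nat) : R * R :=
  match n with
  | O => (1, 1)
  | S m => let '(c, c') := extremal_pair alpha m in
           (c', (c' + alpha * INR m * c) / INR (S (S m)))
  end.

Definition extremal_coeff (alpha : R) (n : nat) : R := fst (extremal_pair alpha n).

Lemma extremal_coeff_rec (alpha : R) (n : nat) :
  INR (S (S n)) * extremal_coeff alpha (S (S n))
  = extremal_coeff alpha (S n) + alpha * INR n * extremal_coeff alpha n.
Proof.
assert (Hn : INR (S (S n)) <> 0) by (apply not_0_INR; discriminate).
unfold extremal_coeff.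
change (extremal_pair alpha (S (S n))) with
  (let '(c, c') := (let '(c, c') := extremal_pair alpha n in
           (c', (c' + alpha * INR n * c) / INR (S (S n)))) in
           (c', (c' + alpha * INR (S n) * c) / INR (S (S (S n))))).
change (extremal_pair alpha (S n)) with (let '(c, c') := extremal_pair alpha n in
           (c', (c' + alpha * INR n * c) / INR (S (S n)))).
destruct (extremal_pair alpha n) as [c c']. cbn [fst]. field. exact Hn.
Qed.

Lemma extremal_coeff_bounds (alpha : R) : 0 < alpha < 1 ->
  forall n, 0 <= extremal_coeff alpha n <= 1.
Proof.
intros Ha.
assert (H : forall n, 0 <= extremal_coeff alpha n <= 1 /\ 0 <= extremal_coeff alpha (S n) <= 1).
{ induction n as [| n [IH1 IH2]].
  - unfold extremal_coeff; simpl; lra.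
  - split; [exact IH2 |].
    assert (E := extremal_coeff_rec alpha n).
    assert (Hn := pos_INR n). rewrite !S_INR in E.
    set (c := extremal_coeff alpha n) in *. set (c1 := extremal_coeff alpha (S n)) in *.
    set (c2 := extremal_coeff alpha (S (S n))) in *.
    assert (0 <= alpha * INR n * c <= INR n).
    { split; [apply Rmult_le_pos; [apply Rmult_le_pos |]; lra |].
      assert (0 <= alpha * INR n <= INR n) by nra. nra. }
    split; apply Rmult_le_reg_l with (INR n + 1 + 1); lra. }
intros n; apply H.
Qed.

Lemma extremal_function (alpha : R) : 0 < alpha < 1 ->
  exists (c : nat -> C) (F G : C -> C),
    c O = RtoC 1 /\
    (forall z, Delta z -> is_cpseries c z (F z)) /\
    (forall z, Delta z -> is_cderive F z (G z)) /\
    (forall z, Delta z -> (1 - alpha * z ^ 2) * G z = F z)%C.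
Proof.
intros Ha.
set (c := fun n => RtoC (extremal_coeff alpha n)).
assert (R0 : radius_ge_1 c).
{ apply radius_ge_1_bounded; intros r Hr; exists 1; intros n.
  assert (H := extremal_coeff_bounds alpha Ha n).
  unfold c. rewrite Cmod_R, Rabs_pos_eq by lra.
  assert (Hp : 0 <= r ^ n <= 1).
  { split; [apply pow_le; lra | rewrite <- (pow1 n); apply pow_incr; lra]. }
  nra. }
destruct (ex_cpseries_sum c R0) as [F HF].
destruct (ex_cpseries_sum _ (radius_ge_1_deriv c R0)) as [G HG].
exists c, F, G.
split; [reflexivity |]. split; [exact HF |].
split; [exact (is_cderive_pseries c F G R0 HF HG) |].
intros z Hz.
assert (H2 := is_pseries_incr_1 (K := C_AbsRing) (V := C_NormedModule) _ _ _
   (is_pseries_incr_1 (K := C_AbsRing) (V := C_NormedModule) _ _ _ (HG z Hz))).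
assert (H3 := is_pseries_scal (K := C_AbsRing) (V := C_NormedModule) (RtoC alpha) _ _ _
   (Cmult_comm _ _) H2).
assert (H4 := is_pseries_minus (K := C_AbsRing) (V := C_NormedModule) _ _ _ _ _ (HG z Hz) H3).
assert (E : F z = (G z - alpha * (z * (z * G z)))%C).
{ apply (is_cseries_unique _ _ _ (HF z Hz)).
  refine (is_pseries_ext (K := C_AbsRing) (V := C_NormedModule) _ _ _ _ _ H4).
  intros n.
  unfold PS_minus, PS_plus, PS_opp, PS_scal, deriv_coeffs.
  match goal with |- ?x = ?y => change (@eq C x y) end.
  unfold c. destruct n as [| [| n]].
  - change ((RtoC (INR 1) * RtoC (extremal_coeff alpha 1)) + - (RtoC alpha * RtoC 0) = RtoC (extremal_coeff alpha 0))%C.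
    unfold extremal_coeff; simpl. ring.
  - assert (Er := extremal_coeff_rec alpha 0).
    change ((RtoC (INR 2) * RtoC (extremal_coeff alpha 2)) + - (RtoC alpha * RtoC 0) = RtoC (extremal_coeff alpha 1))%C.
    rewrite <- RtoC_mult, Er. simpl (INR 0). rewrite Rmult_0_r, Rmult_0_l, Rplus_0_r. ring.
  - assert (Er := extremal_coeff_rec alpha (S n)).
    change ((RtoC (INR (S (S (S n)))) * RtoC (extremal_coeff alpha (S (S (S n)))))
       + - (RtoC alpha * (RtoC (INR (S n)) * RtoC (extremal_coeff alpha (S n))))
       = RtoC (extremal_coeff alpha (S (S n))))%C.
    rewrite <- RtoC_mult, Er, RtoC_plus, !RtoC_mult. ring. }
rewrite E. ring.
Qed.

Lemma Delta_opp z : Delta z -> Delta (- z)%C.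
Proof. unfold Delta; now rewrite Cmod_opp. Qed.

Lemma constant_on_disc (H : C -> C) :
  (forall z, Delta z -> is_cderive H z (RtoC 0)) -> forall z, Delta z -> Re (H z) = Re (H (RtoC 0)).
Proof.
intros Hd z Hz.
assert (Hseg := eq_is_derive (V := R_NormedModule) (fun t => Re (H (0 + RtoC t * z)%C)) 0 1).
cbv beta in Hseg.
replace (0 + RtoC 0 * z)%C with (RtoC 0) in Hseg by ring.
replace (0 + RtoC 1 * z)%C with z in Hseg by ring.
symmetry; apply Hseg; [| lra].
intros t Ht.
eapply is_derive_eq.
- apply is_derive_line_Re, Hd. unfold Delta in *.
  replace (0 + RtoC t * z)%C with (RtoC t * z)%C by ring.
  rewrite Cmod_mult, Cmod_R, Rabs_pos_eq by lra.
  assert (Hz0 := Cmod_ge_0 z). nra.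
- replace (z * 0)%C with (RtoC 0) by ring. reflexivity.
Qed.

(** The equation has an even coefficient, so z -> F(z) F(-z) has derivative 0 and is
    constantly F(0)^2 = 1. *)
Lemma extremal_neq0 (alpha : R) (F G : C -> C) :
  0 < alpha < 1 -> F (RtoC 0) = RtoC 1 ->
  (forall z, Delta z -> is_cderive F z (G z)) ->
  (forall z, Delta z -> (1 - alpha * z ^ 2) * G z = F z)%C ->
  forall z, Delta z -> F z <> RtoC 0.
Proof.
intros Ha HF0 HFG Hode z Hz E.
assert (H : Re (F z * F (- z)%C) = Re (F (RtoC 0) * F (- RtoC 0)%C)).
{ apply (constant_on_disc (fun y => F y * F (- y))%C); [| exact Hz].
  clear z Hz E; intros z Hz.
  assert (Ho : is_cderive (fun y => - y)%C z (- (1))%C).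
  { apply (is_derive_opp (V := C_NormedModule)), is_cderive_id. }
  assert (Hm := HFG _ (Delta_opp z Hz)).
  eapply is_cderive_eq.
  - apply is_cderive_mult; [apply HFG, Hz | apply (is_cderive_comp F (fun y => - y)%C z _ _ Hm Ho)].
  - cbv beta. rewrite <- (Hode z Hz), <- (Hode _ (Delta_opp z Hz)).
    ring. }
rewrite E in H. replace (- 0)%C with (RtoC 0) in H by ring.
rewrite HF0 in H. simpl in H. lra.
Qed.

Lemma extremal_exists (alpha : R) : 0 < alpha < 1 ->
  exists f : C -> C, BS alpha f /\ forall z, Delta z -> (zdlog f z - 1)%C = booth alpha z.
Proof.
intros Ha.
destruct (extremal_function alpha Ha) as [c [F [G [Hc0 [HF [HFG Hode]]]]]].
assert (HF0 : F (RtoC 0) = RtoC 1) by (rewrite (is_cpseries_0 _ _ (HF _ Delta_0)); exact Hc0).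
assert (Hn0 := extremal_neq0 alpha F G Ha HF0 HFG Hode).
set (f := fun z => (z * F z)%C).
assert (Hf : forall z, Delta z -> is_cderive f z (F z + z * G z)%C).
{ intros z Hz. eapply is_cderive_eq.
  - apply is_cderive_mult; [apply is_cderive_id | apply HFG, Hz].
  - cbv beta; ring. }
assert (Hk : forall z, Delta z -> (zdlog f z - 1)%C = booth alpha z).
{ intros z Hz. unfold zdlog, booth.
  destruct (Ceq_dec z (RtoC 0)) as [-> | Hz0].
  - unfold Cdiv. ring.
  - rewrite (is_C_derive_unique _ _ _ (Hf z Hz)). unfold f.
    assert (Hd := denominator_neq0 alpha z Ha Hz).
    assert (HFz := Hn0 z Hz). rewrite <- (Hode z Hz) in *.
    assert (HG : G z <> RtoC 0) by (intros E; apply HFz; rewrite E; ring).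
    field. repeat split; assumption. }
assert (Hkan : analytic (booth alpha)).
{ intros z Hz; eexists; apply is_cderive_booth; assumption. }
exists f; split; [| exact Hk]. split; [split | split].
- intros z Hz; eexists; now apply Hf.
- exists (PS_incr_1 (K := C_AbsRing) (V := C_NormedModule) c).
  split; [reflexivity |]. split; [exact Hc0 |].
  intros z Hz. apply (is_pseries_incr_1 (K := C_AbsRing) (V := C_NormedModule)), HF, Hz.
- intros z Hz Hz0; unfold f; apply Cmult_neq_0; [exact Hz0 | now apply Hn0].
- split; [| split; [exact Hkan |]].
  + intros z Hz. destruct (Hkan z Hz) as [l Hl]. exists l.
    eapply is_cderive_near_ext; [| exact Hl].
    eapply cnear_imp; [| apply (Delta_cnear z Hz)].
    intros y Hy; symmetry; now apply Hk.
  + exists (fun z => z); split; [| split; [auto | split; [reflexivity | exact Hk]]].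
    intros z _; eexists; apply is_cderive_id.
Qed.

Lemma booth_real (alpha t : R) : 0 < alpha < 1 -> -1 < t < 1 ->
  booth alpha (RtoC t) = RtoC (t / (1 - alpha * t ^ 2)).
Proof.
intros Ha Ht.
assert (Hd : 1 - alpha * t ^ 2 <> 0).
{ assert (t ^ 2 < 1) by nra. nra. }
unfold booth.
now rewrite RtoC_div, RtoC_minus, RtoC_mult, RtoC_pow.
Qed.

(** On the rays through 1 and -1 the function booth takes the real values
    sigma t / (1 - alpha t^2), so both radial estimates hold with the same sigma. *)
Lemma extremal_modulus (alpha r sigma : R) (f : C -> C) :
  0 < alpha < 1 -> 0 < r < 1 -> sigma = 1 \/ sigma = -1 -> BS alpha f ->
  (forall z, Delta z -> (zdlog f z - 1)%C = booth alpha z) ->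
  Cmod (f (RtoC r * RtoC sigma)%C) = r * exp (sigma * log_growth alpha r).
Proof.
intros Ha Hr Hs [HA [Hf0 _]] Hk.
destruct (class_A_smooth f HA) as [Hf00 [f1 [Hf10 Hf1]]].
assert (Hder : forall y, Delta y -> is_cderive f y (f1 y)) by (intros y Hy; now apply Hf1).
assert (Hu : Cmod (RtoC sigma) = 1).
{ rewrite Cmod_R. destruct Hs as [-> | ->]; [apply Rabs_R1 | rewrite Rabs_left; lra]. }
assert (Hre : forall t, 0 < t <= r ->
  Re (zdlog f (RtoC t * RtoC sigma)%C) - 1 = sigma * (t / (1 - alpha * t ^ 2))).
{ intros t Ht.
  assert (HD : Delta (RtoC t * RtoC sigma)%C).
  { unfold Delta. rewrite Cmod_mult, Hu, Cmod_R, Rabs_pos_eq; lra. }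
  assert (E := Hk _ HD). rewrite <- RtoC_mult in E at 2.
  rewrite booth_real in E by (try assumption; destruct Hs as [-> | ->]; lra).
  apply (f_equal Re) in E. unfold Cminus in E.
  rewrite re_plus, re_opp, !re_RtoC in E.
  unfold Rminus at 1. rewrite E.
  assert (Hd := denominator_pos alpha t Ha ltac:(lra)).
  replace ((t * sigma) ^ 2) with (t ^ 2) by (destruct Hs as [-> | ->]; ring).
  field. lra. }
apply Rle_antisym.
- apply (Cmod_ray_le f f1); try assumption. intros t Ht. right; now apply Hre.
- apply (Cmod_ray_ge f f1); try assumption. intros t Ht. right; symmetry; now apply Hre.
Qed.

Lemma opp_fhat_opp (alpha r : R) : 0 < alpha < 1 -> 0 < r < 1 ->
  (- fhat alpha (RtoC (- r)))%C = RtoC (r * exp (- log_growth alpha r)).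
Proof.
intros Ha Hr. rewrite fhat_real, log_growth_opp by (try assumption; lra).
rewrite <- RtoC_opp. f_equal; ring.
Qed.

(** * The growth theorem *)

Theorem theorem3p1 (alpha : R) (halpha : 0 < alpha < 1) :
  (forall f : C -> C, BS alpha f ->
     forall (r : R) (z : C), 0 < r < 1 -> Cmod z = r ->
       Cle (- fhat alpha (RtoC (- r)))%C (RtoC (Cmod (f z))) /\
       Cle (RtoC (Cmod (f z))) (fhat alpha (RtoC r))) /\
  (forall r : R, 0 < r < 1 ->
     (exists (f : C -> C) (z : C),
        BS alpha f /\ Cmod z = r /\
        RtoC (Cmod (f z)) = (- fhat alpha (RtoC (- r)))%C) /\
     (exists (f : C -> C) (z : C),
        BS alpha f /\ Cmod z = r /\
        RtoC (Cmod (f z)) = fhat alpha (RtoC r))).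
Proof.
split.
- intros f Hf r z Hr Hz.
  assert (H := BS_growth alpha f z halpha Hf ltac:(lra)). rewrite Hz in H.
  rewrite opp_fhat_opp, fhat_real by (try assumption; lra).
  split; (split; [reflexivity | simpl; lra]).
- intros r Hr. destruct (extremal_exists alpha halpha) as [f [Hf Hk]].
  split; [exists f, (RtoC r * RtoC (-1))%C | exists f, (RtoC r * RtoC 1)%C];
    (split; [exact Hf | split]).
  + rewrite Cmod_mult, !Cmod_R, (Rabs_left (-1)), Rabs_pos_eq; lra.
  + rewrite (extremal_modulus alpha r (-1) f) by auto.
    rewrite opp_fhat_opp by assumption. do 3 f_equal; ring.
  + rewrite Cmod_mult, !Cmod_R, Rabs_R1, Rabs_pos_eq; lra.
  + rewrite (extremal_modulus alpha r 1 f) by auto.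
    rewrite fhat_real by (try assumption; lra). do 3 f_equal; ring.
Qed.
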